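(* Let $a<b$ be real numbers. There is a constant $c$ depending only on $b-a$ such that the following holds. Let $f:[a,b]\to\mathbb{R}$ be such that $V(f)<\infty$ and $\operatorname{supp}f\subset[a+R,b-R]$ for some $R>0$. Then $$\int_a^b f(x)^2\,dx\le c\int_a^b \left(DM_Rf(x)\right)^2dx.$$
   Context: $V(f)=\sup\sum_{j=2}^L|f(x_j)-f(x_{j-1})|$, the supremum over all finite sets $x_1<\dots<x_L$ in $[a,b]$. $\lambda$ is Lebesgue measure. For $R>0$ the local noncentered maximal function of $f$ on $[a,b]$ is $M_Rf(x)=\sup\frac{1}{\lambda(J)}\int_J|f(y)|\,dy$, the supremum over nondegenerate intervals $J\subset[a,b]$ with $x\in J$ and $\lambda(J)\le R$. For $f$ of bounded variation $M_Rf$ is absolutely continuous, and $DM_Rf$ is its derivative (the a.e. pointwise derivative, which coincides with the distributional one). The right-hand side may be $+\infty$. *)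

(* Defs.v *)
From mathcomp Require Import all_boot all_order all_algebra.
From mathcomp Require Import all_classical all_reals all_analysis.
Import Order.TTheory GRing.Theory Num.Theory.
Import numFieldNormedType.Exports.
Set Implicit Arguments.
Unset Strict Implicit.
Unset Printing Implicit Defensive.
Local Open Scope classical_set_scope.
Local Open Scope ring_scope.

(* Functions on [a, b] are represented by total functions on R; every
   definition below reads f on [a, b] only. *)

Definition average (R : realType) (f : R -> R) (J : interval R) : \bar R :=
  ((fine (lebesgue_measure [set` J]))^-1%:E *
   \int[lebesgue_measure]_(y in [set` J]) `|f y|%:E)%E.

(* An interval (open, closed or half-open) is nondegenerate iff its length is
   positive. *)
Definition admissible (R : realType) (a b r x : R) : set (interval R) :=
  [set J : interval R | [/\ [set` J] `<=` `[a, b], x \in J,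
               (0 < lebesgue_measure [set` J])%E &
               (lebesgue_measure [set` J] <= r%:E)%E]].

Definition local_maximal_ereal (R : realType) (a b r : R) (f : R -> R) (x : R) :
    \bar R :=
  ereal_sup [set average f J | J in admissible a b r x].

(* The supremum above is finite when x is in [a, b], 0 < r and f is bounded on
   [a, b], in particular when f has bounded variation there. *)
Definition local_maximal (R : realType) (a b r : R) (f : R -> R) (x : R) : R :=
  fine (local_maximal_ereal a b r f x).

Definition supp_on (R : realType) (a b : R) (f : R -> R) : set R :=
  closure [set x | `[a, b]%classic x /\ f x != 0].

(* Main.v *)
Require Import Defs.
From mathcomp Require Import all_boot all_order all_algebra.
From mathcomp Require Import all_classical all_reals all_analysis.
From mathcomp Require Import measurable_realfun ring lra.
Import Order.TTheory GRing.Theory Num.Theory.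
Import numFieldNormedType.Exports.
Set Implicit Arguments.
Unset Strict Implicit.
Unset Printing Implicit Defensive.
Local Open Scope classical_set_scope.
Local Open Scope ring_scope.

(* Let M be the maximal function and N y the supremum of M over [a, y], so that N a = 0
   by the support condition and |f| <= N b almost everywhere by Lebesgue differentiation.
   The point is that N b <= int |M'|; then (N b)^2 <= (b - a) int M'^2 by AM-GM, and c
   can be taken to be (b - a)^2.

   No absolute continuity of M is used: a left-continuous N grows by at most the growth
   of a nondecreasing P as soon as every y has some t > y with N t - N y <= P t - P y
   (lemma creeping). Let M_d be the supremum of averages over intervals of length at
   least d; it is Lipschitz and M_d <= M <= N. If N does not stay constant to the right
   of y, there are two cases.
   - For some d, N = M_d at points t arbitrarily close to y on the right. Since M_d is
     Lipschitz and M_d <= M <= N with N nondecreasing, M has the derivative of M_d at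
     almost all such y, and |M'| controls the growth of N.
   - Otherwise the averages that yield N t use shorter and shorter intervals as t
     tends to y, so that |f| has right limit N y at y, while |f| <= N y + e (t - y) for
     some t arbitrarily close to y. There N - |f| grows at least like N, from the right
     limit 0. This growth is seen by the truncation of N - |f| at height s, whose total
     variation tends to 0 with s, since N - |f| has bounded variation. *)

(** * Growth comparison from one-sided local steps *)

Section creeping.
Context {R : realType}.
Implicit Types (a b : R) (N P : R -> R).

(** For a nondecreasing [N] this is left continuity on []a, b]]. *)
Definition left_lsc a b N := forall y, a < y <= b -> forall e : R, 0 < e ->
  exists2 d : R, 0 < d & forall t : R, y - d < t -> t <= y -> N y - e <= N t.

(** Let [y] be the supremum of the points [t] with [N t - P t <= N a - P a]. Left lower
    semicontinuity of [N] and monotonicity of [P] carry the inequality to [y] itself, and if [y < b]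
    the step at [y] produces a larger such point. Hence [y = b]. *)
Lemma creeping a b N P : a < b -> left_lsc a b N ->
  {in `[a, b] &, nondecreasing_fun P} ->
  (forall y, a <= y < b -> exists t, [/\ y < t, t <= b & N t - N y <= P t - P y]) ->
  N b - N a <= P b - P a.
Proof.
move=> ab lN ndP step; rewrite leNgt; apply/negP => NP.
pose c := N a - P a.
pose S := [set t | a <= t <= b /\ N t - P t <= c].
have Sa : S a by split; rewrite ?lexx ?(ltW ab)// /c.
have Sb : has_ubound S by exists b => t [/andP[]].
have hS : has_sup S by split=> //; exists a.
pose y := sup S.
have ay : a <= y by exact: ub_le_sup.
have yb : y <= b by apply: ge_sup; [exists a|move=> t [/andP[]]].
have Sy : S y.
  split; first by rewrite ay.
  have [ya|ya] := eqVneq y a; first by rewrite ya.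
  apply/ler_addgt0Pr => e e0.
  have ya' : a < y by rewrite lt_neqAle eq_sym ya.
  have [|d d0 dN] := lN y _ e e0; first by rewrite ya'.
  have [t [tab tc] yt] := sup_adherent d0 hS.
  have ty : t <= y by apply: ub_le_sup.
  have := dN t yt ty.
  have /= := ndP t y _ _ ty; rewrite !in_itv/= => /(_ tab).
  rewrite ay yb => /(_ erefl).
  move: tc; lra.
have {}yb : y < b.
  rewrite lt_neqAle yb andbT; apply/negP => /eqP yb'.
  by case: Sy => _; rewrite yb' /c; lra.
have [|t [yt tb Nt]] := step y; first by rewrite ay.
suff /(ub_le_sup Sb) : S t by rewrite leNgt yt.
split; first by rewrite (le_trans ay (ltW yt)).
by case: Sy => _; lra.
Qed.

End creeping.

(** * Derivatives in division-free form *)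

Section slope.
Context {R : realType}.
Implicit Types (F : R -> R) (x l : R).

(** Multiplying out the difference quotient includes [t = x] and lets such estimates be added
    linearly. *)
Definition has_slope F x l := forall e : R, 0 < e -> exists2 d : R, 0 < d &
  forall t : R, `|t - x| < d -> `|F t - F x - l * (t - x)| <= e * `|t - x|.

Lemma has_slopeP F x l :
  has_slope F x l <-> derivable F x 1 /\ derive1 F x = l.
Proof.
have E k h : h != 0 -> h^-1 *: (F (h + x) - F x) - k =
    h^-1 * (F (h + x) - F x - k * h).
  by move=> h0; rewrite /GRing.scale/= (mulrBr _ _ (k * h)) mulrCA mulVf ?mulr1.
split => [H|[dF <-]].
  have H1 : h^-1 *: (F (h + x) - F x) @[h --> 0^'] --> l.
    apply/cvgrPdist_le => e e0; have [d d0 Hd] := H e e0.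
    near=> h; have h0 : h != 0 by near: h; exact: nbhs_dnbhs_neq.
    rewrite distrC E// normrM normfV ler_pdivrMl ?normr_gt0// [leRHS]mulrC.
    have := Hd (h + x); rewrite addrK; apply.
    by near: h; apply: dnbhs0_lt.
  split; last exact/cvg_lim.
  apply/cvg_ex; exists l; move: H1.
  by under [in X in _ -> X]eq_fun do rewrite /= [X in F (X + _)]mulr1.
have H1 : h^-1 *: (F (h + x) - F x) @[h --> 0^'] --> derive1 F x.
  move: dF; rewrite /derivable.
  by under [X in cvg (X @ _)]eq_fun do rewrite /= [X in F (X + _)]mulr1.
move=> e e0.
have [d /= d0 Hd] := (cvgrPdist_le _ _).1 H1 e e0; exists d => // t td.
have [->|tx] := eqVneq t x; first by rewrite !subrr mulr0 subrr normr0 mulr0.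
have tx0 : t - x != 0 by rewrite subr_eq0.
have := Hd (t - x); rewrite /= sub0r normrN => /(_ td tx0).
by rewrite distrC E// subrK normrM normfV ler_pdivrMl ?normr_gt0// [leRHS]mulrC.
Unshelve. all: by end_near. Qed.

End slope.

(** * A small monotone function that is infinitely steep on a null set *)

Section null_steep.
Context {R : realType}.
Local Notation mu := (@lebesgue_measure R).

(** Cover [Z] by open sets [U k] of measure at most [e / 2 ^ k.+1], and let [w t] be the sum over
    [k] of the measures of the parts of [U k] up to [t]. The total is at most [e]. A point of [Z]
    has, for each [n], a neighbourhood inside the first [n] sets, on which [w] grows at rate at
    least [n]. *)
Lemma null_steep (Z : set R) (e : R) : mu.-negligible Z -> 0 < e ->
  exists w : R -> R, [/\ {homo w : x y / x <= y}, forall x y, w y - w x <= e &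
    forall y, Z y -> forall K, exists2 d : R, 0 < d &
      forall t : R, y < t -> t < y + d -> K * (t - y) <= w t - w y].
Proof.
move=> /negligible_outer_measure Z0 e0.
have ek0 k : 0 < e / (2 ^ k.+1)%:R by rewrite divr_gt0// ltr0n expn_gt0.
have /choice[U HU] : forall k, exists V : set R,
    [/\ open V, Z `<=` V & (mu V <= (e / (2 ^ k.+1)%:R)%:E)%E].
  move=> k; have [V [oV ZV]] := outer_measure_open_le Z (ek0 k).
  by rewrite Z0 add0e => mV; exists V.
have mU k : measurable (U k) by apply: open_measurable; have [] := HU k.
have mUI k (i : interval R) : measurable (U k `&` [set` i]).
  by apply: measurableI => //; exact: measurable_itv.
pose S (i : interval R) : \bar R := (\sum_(0 <= k <oo) mu (U k `&` [set` i]))%E.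
have S0 i : (0 <= S i)%E by apply: nneseries_ge0 => *; exact: measure_ge0.
have Se i : (S i <= e%:E)%E.
  apply: (@le_trans _ _ (\sum_(0 <= k <oo) (0 + (e / (2 ^ k.+1)%:R)%:E))%E).
    apply: lee_nneseries => k *; first exact: measure_ge0.
    rewrite add0e; have [_ _] := HU k; apply: le_trans.
    by apply: le_measure; rewrite ?inE//; [exact: mUI|exact: mU].
  have := @epsilon_trick R (fun=> 0%E) e xpredT (fun=> lexx _) (ltW e0).
  by rewrite [X in (_ <= X + _)%E]eseries0// add0e.
have Sf i : S i \is a fin_num.
  by rewrite ge0_fin_numE//; apply: le_lt_trans (Se i) _; rewrite ltry.
pose w t := fine (S `]-oo, t]).
have wB y t : y <= t -> w t = w y + fine (S `]y, t]).
  move=> yt; rewrite /w -fineD//; congr fine.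
  rewrite /S -nneseriesD//.
  apply: eq_eseriesr => k _; rewrite -measureU; [|exact: mUI|exact: mUI|]; last first.
    apply/seteqP; split => // z [[_ /=]] + [_ /=].
    by rewrite !in_itv/= => zy /andP[]; rewrite ltNge zy.
  rewrite -setIUr; congr (mu (_ `&` _)).
  by rewrite -itv_bndbnd_setU//= bnd_simp.
exists w; split.
- by move=> x y xy; rewrite (wB x y)// lerDl fine_ge0.
- move=> x y; apply: (@le_trans _ _ (w y)); first by rewrite gerBl fine_ge0.
  by rewrite -lee_fin fineK.
move=> y Zy K; pose n := (Num.truncn K).+1.
have : \forall t \near y, forall k : 'I_n, U k t.
  apply: (@filter_forall _ _ (fun (k : 'I_n) t => U k t) (nbhs y) _) => k.
  apply: open_nbhs_nbhs; have [oU ZU _] := HU k; split=> //; exact: ZU.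
move=> /nbhs_ballP[d /= d0 Hd]; exists d => // t yt td.
rewrite (wB y t (ltW yt)) addrAC subrr add0r -lee_fin fineK//.
apply: (@le_trans _ _ (\sum_(0 <= k < n) mu (U k `&` `]y, t]))%E); last first.
  by apply: nneseries_lim_ge => *; exact: measure_ge0.
rewrite (eq_big_nat _ _ (F2 := fun=> (t - y)%:E)); last first.
  move=> k /andP[_ kn]; rewrite setIidr ?lebesgue_measure_itv/= ?lte_fin ?yt//.
  move=> z /=; rewrite in_itv/= => /andP[yz zt]; apply: (Hd z _ (Ordinal kn)) => /=.
  rewrite /ball/= distrC ger0_norm ?subr_ge0 ?ltW//; lra.
rewrite sumEFin lee_fin big_const_nat iter_addr_0 subn0 -mulr_natl.
rewrite ler_wpM2r ?subr_ge0 ?ltW//.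
exact: truncnS_gt.
Qed.

End null_steep.

(** * Growth comparison with an integral and a null exceptional set *)

Section creeping_integral.
Context {R : realType}.
Local Notation mu := (@lebesgue_measure R).
Implicit Types (a b : R) (N P psi : R -> R) (Z : set R).

Lemma primitive_slope psi : mu.-integrable setT (EFin \o psi) ->
  {ae mu, forall x, has_slope (fun y => \int[mu]_(t in `]-oo, y]) psi t) x (psi x)}.
Proof.
move=> ipsi.
have lpsi : locally_integrable setT psi.
  exact: open_integrable_locally openT ipsi.
have := @FTC1Ny R psi _ lpsi.
have ipsi' (y : R) : mu.-integrable `]-oo, y] (EFin \o psi).
  by apply: integrableS ipsi => //; exact: measurable_itv.
move=> /(_ ipsi'); apply: filterS; first exact: (ae_filter_ringOfSetsType mu).
by move=> x /has_slopeP.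
Qed.

Lemma primitive_nondecreasing psi : mu.-integrable setT (EFin \o psi) ->
  (forall x, 0 <= psi x) ->
  {homo (fun y => \int[mu]_(t in `]-oo, y]) psi t) : x y / x <= y}.
Proof.
move=> ipsi psi0 x y xy.
rewrite -subr_ge0 Rintegral_itvB//=.
- by apply: Rintegral_ge0.
- by apply: integrableS ipsi => //; exact: measurable_itv.
Qed.

(** This is [creeping] with [P] enlarged by the primitive of [psi], by a steep function of small
    oscillation, and by a small linear term. Where the primitive has slope [psi y], it pays for the
    rate [psi y]. On the null set a finite rate [K] suffices, since the steep function outgrows
    every [K]. *)
Lemma creeping_integral a b N P psi Z : a < b -> left_lsc a b N ->
  {in `[a, b] &, nondecreasing_fun P} ->
  mu.-integrable setT (EFin \o psi) -> (forall x, 0 <= psi x) ->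
  mu.-negligible Z ->
  (forall y, a <= y < b -> ~ Z y -> forall e d : R, 0 < e -> 0 < d ->
    exists t, [/\ y < t, t < y + d & N t - N y <= P t - P y + (psi y + e) * (t - y)]) ->
  (forall y, a <= y < b -> Z y -> exists K, forall d : R, 0 < d ->
    exists t, [/\ y < t, t < y + d & N t - N y <= P t - P y + K * (t - y)]) ->
  N b - N a <= P b - P a + \int[mu]_(t in `]a, b]) psi t.
Proof.
move=> ab lN ndP ipsi psi0 Z0 HnZ HZ.
pose Phi y := \int[mu]_(t in `]-oo, y]) psi t.
have <- : Phi b - Phi a = \int[mu]_(t in `]a, b]) psi t.
  rewrite /Phi Rintegral_itvB// ?bnd_simp ?ltW//.
  by apply: integrableS ipsi => //; exact: measurable_itv.
have ndPhi : {homo Phi : x y / x <= y} by exact: primitive_nondecreasing.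
pose Z' := ~` [set x | has_slope Phi x (psi x)].
have Z'0 : mu.-negligible Z' by exact: primitive_slope.
have ZZ0 : mu.-negligible (Z `|` Z') by apply: negligibleU.
apply/ler_addgt0Pr => e e0.
have e1 : 0 < e / 2 by lra.
have e2 : 0 < e / (4 * (b - a)) by rewrite divr_gt0// mulr_gt0// subr_gt0.
set e' := e / _ in e2.
have [w [ndw wB Hw]] := null_steep ZZ0 e1.
(* The linear term has slope [2 * e']: one [e'] pays for the error in the hypothesis off [Z], the
   other for the error in the slope of [Phi]. Over [[a, b]] it contributes [e / 2], and [w]
   contributes at most another [e / 2]. *)
pose P' t := P t + Phi t + w t + 2 * e' * t.
have := @creeping R a b N P' ab lN.
have -> : P' b - P' a = P b - P a + (Phi b - Phi a) + (w b - w a) + 2 * e' * (b - a).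
  by rewrite /P'; ring.
have -> : 2 * e' * (b - a) = e / 2.
  by rewrite /e'; field; rewrite subr_eq0 gt_eqF.
suff H : {in `[a, b] &, nondecreasing_fun P'} /\
    forall y, a <= y < b -> exists t, [/\ y < t, t <= b & N t - N y <= P' t - P' y].
  by case: H => H1 H2 /(_ H1 H2) /le_trans; apply; have := wB a b; lra.
split.
  move=> x y xab yab xy; rewrite /P' !lerD//; [exact: ndP|exact: ndPhi|exact: ndw|].
  by rewrite ler_wpM2l// mulr_ge0// ltW.
move=> y /[dup] yab /andP[ay yb].
have yb0 : 0 < b - y by rewrite subr_gt0.
have PP t : P' t - P' y = (P t - P y) + (Phi t - Phi y) + (w t - w y) + 2 * e' * (t - y).
  by rewrite /P'; ring.
have [ZZy|] := pselect ((Z `|` Z') y); last first.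
  move=> /not_orP[nZ /contrapT slo].
  have [d d0 Hd] := slo _ e2.
  have dm0 : 0 < Num.min d (b - y) by rewrite lt_min d0.
  have [t [yt td Nt]] := HnZ y yab nZ e' _ e2 dm0.
  have [td1 td2] : t - y < d /\ t - y < b - y.
    by move: td; rewrite -ltrBlDl lt_min => /andP[].
  exists t; split=> //; first by lra.
  apply: le_trans Nt _; rewrite PP.
  have ty0 : 0 <= t - y by lra.
  have := Hd t; rewrite ger0_norm// => /(_ td1); rewrite ler_norml => /andP[+ _].
  have := ndw y t (ltW yt); rewrite -/(Phi t) -/(Phi y).
  rewrite mulrDl; lra.
(* Where only the slope of [Phi] fails, the hypothesis off [Z] still gives the finite rate
   [psi y + 1]. *)
have [K HK] : exists K, forall d : R, 0 < d ->
    exists t, [/\ y < t, t < y + d & N t - N y <= P t - P y + K * (t - y)].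
  have [Zy|nZ] := pselect (Z y); first exact: HZ.
  by exists (psi y + 1) => d d0; apply: HnZ => //.
have [d d0 Hd] := Hw y ZZy K.
have dm0 : 0 < Num.min d (b - y) by rewrite lt_min d0.
have [t [yt td Nt]] := HK _ dm0.
have [td1 td2] : t - y < d /\ t - y < b - y.
  by move: td; rewrite -ltrBlDl lt_min => /andP[].
exists t; split=> //; first by lra.
apply: le_trans Nt _; rewrite PP.
have := Hd t yt; rewrite -ltrBlDl => /(_ td1).
have := ndPhi y t (ltW yt).
have : 0 <= 2 * e' * (t - y) by rewrite mulr_ge0 ?subr_ge0 ?(ltW yt)// mulr_ge0// ltW.
lra.
Qed.

End creeping_integral.

(** * Almost everywhere differentiability of nondecreasing Lipschitz functions *)

Section lipschitz.
Context {R : realType}.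
Local Notation mu := (@lebesgue_measure R).
Implicit Types (F : R -> R) (L : R).

Lemma limn_sup_bounds (v : R^nat) (B : R) : (forall n, `|v n| <= B) ->
  (forall e : R, 0 < e -> exists n, forall k, (n <= k)%N -> v k <= limn_sup v + e) /\
  (forall (e : R) n, 0 < e -> exists2 k, (n <= k)%N & limn_sup v - e <= v k).
Proof.
move=> vB.
have bv : bounded_fun v.
  by exists B; split=> [|M BM n _]; [exact: num_real|exact: le_trans (vB n) (ltW BM)].
have uv : has_ubound (range v).
  by exists B => _ [n _ <-]; exact: le_trans (ler_norm _) (vB n).
have us n : has_sup (sdrop v n).
  split; first by exists (v n); exists n => /=.
  exact: has_ubound_sdrop.
have hi : has_inf (range (sups v)).
  split; first by exists (sups v 0%N); exists 0%N.
  exists (- B) => _ [n _ <-]; apply: (@le_trans _ _ (v n)).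
    by have := vB n; rewrite ler_norml => /andP[].
  by apply: (sup_upper_bound (us n)); exists n => /=.
rewrite limn_supE//; split=> [e e0|e n e0].
  have [_ [n _ <-] Hn] := inf_adherent e0 hi.
  exists n => k nk; apply: ltW; apply: le_lt_trans Hn.
  by apply: (sup_upper_bound (us n)); exists k.
have [_ [k /= nk <-] Hk] := sup_adherent e0 (us n).
exists k => //; apply: ltW; apply: le_lt_trans Hk.
by rewrite lerD2r; apply: ge_inf; [case: hi|exists n].
Qed.

Definition quot F (k : nat) (y : R) : R := (F (y + k.+1%:R^-1) - F y) * k.+1%:R.

(** The upper limit is taken along the steps [1 / (k + 1)] only, so that it is a limit superior of a
    sequence of measurable functions. By [lipschitz_slope] it is the derivative almost everywhere
    when [F] is nondecreasing and Lipschitz. *)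
Definition upper_quot F (y : R) : R := limn_sup (quot F ^~ y).

Lemma quot_bounds F L : {homo F : x y / x <= y} ->
  (forall x y, x <= y -> F y - F x <= L * (y - x)) ->
  forall k y, 0 <= quot F k y <= L.
Proof.
move=> ndF lF k y; rewrite /quot.
have k0 : 0 < k.+1%:R :> R by [].
have yk : y <= y + k.+1%:R^-1 by rewrite lerDl invr_ge0.
rewrite mulr_ge0 ?subr_ge0 ?ndF//=.
by rewrite -ler_pdivlMr//; have := lF _ _ yk; rewrite addrAC subrr add0r.
Qed.

Lemma upper_quot_bounds F L : {homo F : x y / x <= y} ->
  (forall x y, x <= y -> F y - F x <= L * (y - x)) ->
  forall y, 0 <= upper_quot F y <= L.
Proof.
move=> ndF lF y; have qB := quot_bounds ndF lF.
have [|H1 H2] := @limn_sup_bounds (quot F ^~ y) L.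
  by move=> n; have /andP[q0 q1] := qB n y; rewrite ger0_norm.
apply/andP; split; apply/ler_addgt0Pr => e e0.
  have [n /(_ _ (leqnn n))] := H1 _ e0.
  by apply: le_trans; have /andP[] := qB n y.
have [k _] := H2 _ 0%N e0; have /andP[_] := qB k y.
by rewrite /upper_quot; lra.
Qed.

Lemma measurable_upper_quot F L : {homo F : x y / x <= y} ->
  (forall x y, x <= y -> F y - F x <= L * (y - x)) ->
  measurable_fun setT (upper_quot F).
Proof.
move=> ndF lF; have qB := quot_bounds ndF lF.
apply: measurable_fun_limn_sup.
- by move=> y _; exists L => _ [k _ <-]; have /andP[] := qB k y.
- by move=> y _; exists 0 => _ [k _ <-]; have /andP[] := qB k y.
move=> k; apply: measurable_funM => //; apply: measurable_funB.
  apply: (@measurableT_comp _ _ _ _ _ _ F); first exact: nondecreasing_measurable.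
  exact: measurable_funD.
exact: nondecreasing_measurable.
Qed.

Lemma bounded_restr_integrable (g : R -> R) (L a b : R) : measurable_fun setT g ->
  (forall y, 0 <= g y <= L) -> mu.-integrable setT (EFin \o (g \_ `[a, b])).
Proof.
move=> mg gB; rewrite -restrict_EFin; apply/(integrable_mkcond _ _).1 => //.
apply: measurable_bounded_integrable => //.
- by rewrite /= lebesgue_measure_itv/=; case: ifP => _; rewrite ?ltry// -EFinB ltry.
- exact: measurable_funTS.
- exists L; split=> [|M LM y _]; first exact: num_real.
  have /andP[g0 gL] := gB y.
  by rewrite /= ger0_norm// (le_trans gL)// ltW.
Qed.

Lemma integrable_cst_itv (c a b : R) (x y : bool) :
  mu.-integrable [set` Interval (BSide x a) (BSide y b)] (EFin \o cst c).
Proof.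
apply: measurable_bounded_integrable => //.
  by rewrite /= lebesgue_measure_itv/=; case: ifP => _; rewrite ?ltry// -EFinB ltry.
exists `|c|; split=> [|M cM t _]; first exact: num_real.
by rewrite /= ltW.
Qed.

(** By definition of the upper limit, some [t] arbitrarily close to the right of [y] has [F t - F y]
    at least [(upper_quot F y - e) * (t - y)]. So [L * x - F x] satisfies the local steps of
    [creeping_integral] with rate [L - upper_quot F], which is nonnegative. *)
Lemma lipschitz_ge_integral F L a b : a < b -> {homo F : x y / x <= y} ->
  (forall x y, x <= y -> F y - F x <= L * (y - x)) ->
  \int[mu]_(y in `]a, b]) upper_quot F y <= F b - F a.
Proof.
move=> ab ndF lF.
have uB := upper_quot_bounds ndF lF.
have mu_ := measurable_upper_quot ndF lF.
pose g y := L - upper_quot F y.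
have gB y : 0 <= g y <= L by have := uB y; rewrite /g; lra.
have mg : measurable_fun setT g by exact: measurable_funB.
have ig := bounded_restr_integrable a b mg gB.
have iu : mu.-integrable `]a, b] (EFin \o upper_quot F).
  have := bounded_restr_integrable a b mu_ uB.
  rewrite -restrict_EFin => /(integrable_mkcond _ _).2 => /(_ (measurable_itv _)).
  by apply: integrableS => //; exact: subset_itv_oc_cc.
pose N x := L * x - F x.
have lN : left_lsc a b N.
  move=> y _ e e0.
  have N0 : 0 < `|L| + 1 by rewrite ltr_wpDl.
  exists (e / (`|L| + 1)); first by rewrite divr_gt0.
  move=> t yt ty; rewrite /N.
  have := ndF _ _ ty.
  have : y - t < e / (`|L| + 1) by lra.
  rewrite ltr_pdivlMr// => H.
  have : L * (y - t) <= (y - t) * (`|L| + 1).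
    rewrite mulrC ler_wpM2l ?subr_ge0//.
    by rewrite (le_trans (ler_norm L))// lerDl.
  rewrite mulrBr; lra.
have := @creeping_integral R a b N (cst 0) (g \_ `[a, b]) set0 ab lN.
have -> : \int[mu]_(t in `]a, b]) (g \_ `[a, b]) t =
    L * (b - a) - \int[mu]_(y in `]a, b]) upper_quot F y.
  transitivity (\int[mu]_(t in `]a, b]) (cst L t - upper_quot F t)).
    apply: eq_Rintegral => y; rewrite inE/= in_itv/= => /andP[ay yb].
    by rewrite patchE mem_set//= in_itv/= yb ltW.
  rewrite RintegralB//; last exact: integrable_cst_itv.
  rewrite Rintegral_cst//= lebesgue_measure_itv/= lte_fin ab.
  by rewrite -EFinB.
move=> H; suff : N b - N a <= L * (b - a) - \int[mu]_(y in `]a, b]) upper_quot F y.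
  by rewrite /N; lra.
rewrite -[leRHS]add0r -[X in _ <= X + _](subrr 0); apply: H => //.
- by move=> y; rewrite patchE; case: ifP => // _; have /andP[] := gB y.
- exact: negligible_set0.
move=> y /andP[ay yb] _ e d e0 d0.
have [|_ H2] := @limn_sup_bounds (quot F ^~ y) L.
  by move=> n; have /andP[q0 q1] := quot_bounds ndF lF n y; rewrite ger0_norm.
have [k nk Hk] := H2 e (Num.truncn d^-1) e0.
have k0 : 0 < k.+1%:R :> R by [].
exists (y + k.+1%:R^-1); split.
- by rewrite ltrDl invr_gt0.
- rewrite ltrD2l invf_plt ?posrE//.
  apply: (lt_le_trans (truncnS_gt _)).
  by rewrite ler_nat.
set t := y + _; have ty : t - y = k.+1%:R^-1 by rewrite /t addrAC subrr add0r.
rewrite [X in _ <= X + _](_ : _ = 0); last by rewrite /= subrr.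
rewrite add0r patchE mem_set/= ?in_itv/= ?ay ?(ltW yb)//.
have : (upper_quot F y - e) * (t - y) <= F t - F y.
  by rewrite ty ler_pdivrMr.
by rewrite /N /g; lra.
Qed.

Lemma upper_quot_integrable F L a b : {homo F : x y / x <= y} ->
  (forall x y, x <= y -> F y - F x <= L * (y - x)) ->
  mu.-integrable `]a, b] (EFin \o upper_quot F).
Proof.
move=> ndF lF.
have := bounded_restr_integrable a b (measurable_upper_quot ndF lF)
  (upper_quot_bounds ndF lF).
rewrite -restrict_EFin => /(integrable_mkcond _ _).2 => /(_ (measurable_itv _)).
by apply: integrableS => //; exact: subset_itv_oc_cc.
Qed.

(** The reverse inequality comes from [lipschitz_ge_integral] for [G x = L * x - F x], which is
    again nondecreasing and Lipschitz. The quotients of [F] and [G] with the same step add up to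
    [L], so the two upper limits add up to at least [L]. *)
Lemma lipschitz_integral F L a b : a < b -> {homo F : x y / x <= y} ->
  (forall x y, x <= y -> F y - F x <= L * (y - x)) ->
  \int[mu]_(y in `]a, b]) upper_quot F y = F b - F a.
Proof.
move=> ab ndF lF; apply/le_anti; rewrite (lipschitz_ge_integral ab ndF lF)/=.
pose G x := L * x - F x.
have ndG : {homo G : x y / x <= y}.
  by move=> x y xy; rewrite /G; have := lF _ _ xy; rewrite mulrBr; lra.
have lG x y : x <= y -> G y - G x <= L * (y - x).
  by move=> xy; rewrite /G; have := ndF _ _ xy; rewrite mulrBr; lra.
have : \int[mu]_(y in `]a, b]) cst L y <=
    \int[mu]_(y in `]a, b]) (upper_quot F y + upper_quot G y).
  apply: le_Rintegral => //.
  - exact: integrable_cst_itv.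
  - have iF := upper_quot_integrable a b ndF lF.
    have iG := upper_quot_integrable a b ndG lG.
    by have := integrableD _ iF iG; apply.
  move=> y _ /=; apply/ler_addgt0Pr => e e0.
  have [|H1 _] := @limn_sup_bounds (quot F ^~ y) L.
    by move=> n; have /andP[q0 q1] := quot_bounds ndF lF n y; rewrite ger0_norm.
  have [|H2 _] := @limn_sup_bounds (quot G ^~ y) L.
    by move=> n; have /andP[q0 q1] := quot_bounds ndG lG n y; rewrite ger0_norm.
  have e2 : 0 < e / 2 by lra.
  have [n1 K1] := H1 _ e2; have [n2 K2] := H2 _ e2.
  have := K1 _ (leq_maxl n1 n2); have := K2 _ (leq_maxr n1 n2).
  set k := maxn n1 n2; rewrite -/(upper_quot F y) -/(upper_quot G y).
  have -> : quot G k y = L - quot F k y.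
    rewrite /quot /G; have k0 : k.+1%:R != 0 :> R by [].
    by field.
  lra.
rewrite Rintegral_cst//= lebesgue_measure_itv/= lte_fin ab -EFinB/=.
rewrite RintegralD//; [|exact: upper_quot_integrable lF|exact: upper_quot_integrable lG].
by have := lipschitz_ge_integral ab ndG lG; rewrite /G mulrBr; lra.
Qed.

(** By [lipschitz_integral], [F] is locally a primitive of [upper_quot F], so Lebesgue
    differentiation applies. *)
Lemma lipschitz_slope F L : {homo F : x y / x <= y} ->
  (forall x y, x <= y -> F y - F x <= L * (y - x)) ->
  {ae mu, forall x, has_slope F x (upper_quot F x)}.
Proof.
move=> ndF lF.
have mu_ := measurable_upper_quot ndF lF.
have uB := upper_quot_bounds ndF lF.
have : {ae mu, forall x, forall n : nat, - n%:R < x < n%:R ->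
    has_slope F x (upper_quot F x)}.
  apply: ae_foralln => n.
  (* Cutting off outside [[- n, n]] makes the function integrable on the line. Inside, the
     increments of its primitive are those of [F]. *)
  pose g := upper_quot F \_ `[- n%:R, n%:R].
  have := primitive_slope (bounded_restr_integrable (- n%:R) n%:R mu_ uB).
  apply: filterS; first exact: (ae_filter_ringOfSetsType mu).
  move=> x slo /andP[nx xn] e e0.
  have gx : g x = upper_quot F x by rewrite /g patchE mem_set//= in_itv/= !ltW.
  rewrite -gx; move: slo; rewrite -/g => slo.
  have [d d0 Hd] := slo e e0.
  have m0 : 0 < Num.min d (Num.min (n%:R - x) (n%:R + x)).
    by rewrite !lt_min d0/=; apply/andP; split; lra.
  exists (Num.min d (Num.min (n%:R - x) (n%:R + x))) => // t.
  rewrite !lt_min => /and3P[td t1 t2].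
  have := Hd t td.
  suff H y z : - n%:R < y -> y <= z -> z < n%:R ->
      \int[mu]_(t in `]-oo, z]) g t - \int[mu]_(t in `]-oo, y]) g t = F z - F y.
    have [xt|/ltW tx] := leP x t.
      rewrite H//; move: t1; rewrite /= ger0_norm ?subr_ge0//; lra.
    rewrite -[X in X - _ * _]opprB H//.
      by rewrite opprB.
    move: t2; rewrite ler0_norm ?subr_le0//; lra.
  move=> ny yz zn.
  rewrite Rintegral_itvB ?bnd_simp//; last first.
    have := bounded_restr_integrable (- n%:R) n%:R mu_ uB.
    by apply: integrableS => //; exact: measurable_itv.
  move: yz; rewrite le_eqVlt => /predU1P[->|yz].
    by rewrite set_itvoc0 Rintegral_set0 subrr.
  rewrite -(lipschitz_integral yz ndF lF); apply: eq_Rintegral => t'.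
  rewrite inE/= in_itv/= => /andP[yt tz].
  by rewrite /g patchE mem_set//= in_itv/=; apply/andP; split; lra.
apply: filterS; first exact: (ae_filter_ringOfSetsType mu).
move=> x /(_ (Num.truncn `|x|).+1); apply.
by rewrite -ltr_norml truncnS_gt.
Qed.

End lipschitz.

(** * Functions of bounded variation *)

Section bounded_variation.
Context {R : realType}.
Implicit Types (a b x y s e : R) (f g h : R -> R) (l : seq R).

Lemma variation_le_dist a b f g l :
  {in `[a, b] &, forall x y, `|f x - f y| <= `|g x - g y|} ->
  itv_partition a b l -> variation a b f l <= variation a b g l.
Proof.
move=> fg abl; rewrite /variation ler_sum_nat// => k /andP[_ kl].
have H m : (m < (size l).+1)%N -> nth b (a :: l) m \in `[a, b].
  move=> ml; rewrite in_itv; apply/andP; split.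
    exact: itv_partition_nth_ge ml abl.
  exact: itv_partition_nth_le ml abl.
by apply: fg; apply: H => //; rewrite ltnS ltnW.
Qed.

Lemma bounded_variation_le_dist a b f g :
  {in `[a, b] &, forall x y, `|f x - f y| <= `|g x - g y|} ->
  bounded_variation a b g -> bounded_variation a b f.
Proof.
move=> fg [M HM]; exists M => _ [l abl <-].
by apply: le_trans (variation_le_dist fg abl) _; apply: HM; exists l.
Qed.

Definition tv a b f : R := fine (total_variation a b f).

Lemma tv_ub a b f l : a <= b -> bounded_variation a b f ->
  itv_partition a b l -> variation a b f l <= tv a b f.
Proof.
move=> ab bf abl; rewrite -lee_fin fineK; last exact/bounded_variationP.
by apply: ereal_sup_ubound; exists (variation a b f l) => //; exists l.
Qed.

Lemma dist_tv a b f : a <= b -> bounded_variation a b f -> `|f b - f a| <= tv a b f.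
Proof.
move=> ab bf; rewrite -lee_fin fineK; last exact/bounded_variationP.
exact: total_variation_ge.
Qed.

Lemma tv_adherent a b f e : a <= b -> bounded_variation a b f -> 0 < e ->
  exists2 l, itv_partition a b l & tv a b f - e < variation a b f l.
Proof.
move=> ab /(bounded_variationP _ ab) bf e0.
have [_ [_ [l abl <-] <-]] := ub_ereal_sup_adherent e0 bf.
rewrite -/(total_variation a b f) -(fineK bf) -EFinB lte_fin => H.
by exists l.
Qed.

Lemma tvD a b c f : a <= c -> c <= b -> bounded_variation a b f ->
  tv a b f = tv a c f + tv c b f.
Proof.
move=> ac cb bf; rewrite /tv (total_variationD _ ac cb) fineD//.
- exact/(bounded_variationP _ ac)/(bounded_variationl ac cb bf).
- exact/(bounded_variationP _ cb)/(bounded_variationr ac cb bf).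
Qed.

Lemma tv_dist a b f x y : bounded_variation a b f -> a <= x -> x <= y -> y <= b ->
  `|f y - f x| <= tv a y f - tv a x f.
Proof.
move=> bf ax xy yb; have ay := le_trans ax xy.
have bfy := bounded_variationl ay yb bf.
rewrite (tvD ax xy bfy) addrAC subrr add0r.
by apply: dist_tv => //; exact: bounded_variationr bfy.
Qed.

(** The variation [tv a t f] is nondecreasing in [t], so close to the right of [y] it is within [e]
    of its infimum over [t > y]. Its increments there bound the oscillation of [f]. *)
Lemma bounded_variation_right_cauchy a b f y e : bounded_variation a b f ->
  a <= y < b -> 0 < e -> exists2 d : R, 0 < d &
    forall u t, y < u -> u < y + d -> y < t -> t < y + d -> `|f u - f t| <= e.
Proof.
move=> bf /andP[ay yb] e0.
pose S := [set tv a t f | t in `]y, b]].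
have S0 : has_inf S.
  split; first by exists (tv a b f); exists b => //=; rewrite in_itv/= yb lexx.
  exists 0 => x [t /=]; rewrite in_itv/= => /andP[yt tb] <-.
  by rewrite fine_ge0// total_variation_ge0// (le_trans ay)// ltW.
have [x [t0 /=]] := inf_adherent e0 S0.
rewrite in_itv/= => /andP[yt0 t0b] <- {x} Ht0.
exists (t0 - y); first by rewrite subr_gt0.
rewrite addrC subrK.
have H u t : y < u -> u <= t -> t < t0 -> `|f t - f u| <= e.
  move=> yu ut tt0; have tb := le_trans (ltW tt0) t0b.
  apply: le_trans (tv_dist bf (le_trans ay (ltW yu)) ut tb) _.
  have : inf S <= tv a u f.
    apply: ge_inf; first by case: S0.
    by exists u => //=; rewrite in_itv/= yu/= (le_trans ut).
  have := tv_dist bf (le_trans ay (ltW (lt_le_trans yu ut))) (ltW tt0) t0b.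
  have := normr_ge0 (f t0 - f t); lra.
move=> u t yu ut0 yt tt0; have [ut|/ltW tu] := leP u t; last exact: H.
by rewrite distrC; exact: H.
Qed.

Lemma bounded_variation_bounded a b f : bounded_variation a b f ->
  exists2 K, 0 <= K & {in `[a, b], forall x, `|f x| <= K}.
Proof.
move=> bf; have [ab|ba] := leP a b; last first.
  exists 0 => // x; rewrite in_itv/= => /andP[ax xb].
  by move: (le_trans ax xb); rewrite leNgt ba.
exists (`|f a| + tv a b f).
  by rewrite addr_ge0// fine_ge0// total_variation_ge0.
move=> x; rewrite in_itv/= => /andP[ax xb].
have := tv_dist bf ax xb (lexx b).
have := dist_tv ax (bounded_variationl ax xb bf).
have := ler_normD (f a) (f x - f a); rewrite [f a + _]addrC subrK.
have := normr_ge0 (f b - f x); lra.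
Qed.

Lemma bounded_variation_measurable a b f : bounded_variation a b f ->
  measurable_fun `[a, b] f.
Proof.
move=> bf; have [ab|ba] := leP a b; last first.
  rewrite set_itv_ge; first exact: measurable_fun_set0.
  by rewrite bnd_simp -ltNge.
(* Clamping to [[a, b]] turns a function monotone on [[a, b]] into one monotone, hence measurable,
   on the whole line. *)
pose c x := Num.max a (Num.min x b).
have cab x : c x \in `[a, b] by rewrite in_itv/= /c le_max lexx/= ge_max ab/= ge_min lexx orbT.
have ndc x y : x <= y -> c x <= c y.
  by move=> xy; rewrite /c ge_max le_max lexx/= le_max le_min !ge_min lexx xy !orbT.
have mono (g : R -> R) : {in `[a, b] &, {homo g : u v / u <= v}} -> measurable_fun `[a, b] (g \o c).
  move=> ndg; have ndgc : {homo g \o c : u v / u <= v}.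
    by move=> u v uv; apply: ndg; rewrite ?cab//; exact: ndc.
  exact: nondecreasing_measurable.
apply: (@eq_measurable_fun _ _ _ _ _
    (fun x => (fine \o pos_tv a f) (c x) - (fine \o neg_tv a f) (c x))).
  move=> x; rewrite inE/= in_itv/= => /andP[ax xb].
  have -> : c x = x by rewrite /c min_l// max_r.
  by rewrite (bounded_variation_pos_neg_tvE bf)// in_itv/= ax.
apply: measurable_funB; apply: mono; last exact: fine_neg_tv_nondecreasing.
rewrite /pos_tv; apply: fine_neg_tv_nondecreasing; exact: bounded_variationN.
Qed.

(* The truncations [minr h s] have vanishing total variation as [s] tends to 0:
   [h] is the sum of [minr h s] and [maxr (h - s) 0], whose variations add up, and
   the second one already carries almost all of the variation of [h]. *)
Lemma truncation_small_variation a b h e : a <= b -> bounded_variation a b h ->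
  (forall x, 0 <= h x) -> 0 < e ->
  exists s P, [/\ 0 < s, {in `[a, b] &, nondecreasing_fun P}, P b - P a <= e &
    forall x y, a <= x -> x <= y -> y <= b ->
      `|Num.min (h y) s - Num.min (h x) s| <= P y - P x].
Proof.
move=> ab bh h0 e0.
have e2 : 0 < e / 2 by lra.
have [l abl Hl] := tv_adherent ab bh e2.
(* The partition [l] has [size l] increments and each increment of [h1] is at most [s], so the
   variation of [h1] along [l] is at most [e / 2]. The successor avoids a division by zero. *)
pose s := e / 2 / (size l).+1%:R.
have s0 : 0 < s by rewrite divr_gt0.
pose h1 x := Num.min (h x) s; pose h2 x := Num.max (h x - s) 0.
have hE x y : `|h x - h y| = `|h1 x - h1 y| + `|h2 x - h2 y|.
  rewrite /h1 /h2; case: (leP (h x) s) => xs; case: (leP (h y) s) => ys.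
  - rewrite !max_r ?subr_le0// subrr normr0 addr0//.
  - rewrite max_r ?subr_le0// max_l ?subr_ge0 ?ltW//.
    rewrite !ler0_norm; lra.
  - rewrite max_l ?subr_ge0 ?ltW// max_r ?subr_le0//.
    rewrite !ger0_norm; lra.
  - rewrite !max_l ?subr_ge0 ?ltW// subrr normr0 add0r.
    by congr (`|_|); lra.
have bh2 : bounded_variation a b h2.
  by apply: bounded_variation_le_dist bh => x y _ _; rewrite hE lerDr.
have vE x y p : variation x y h p = variation x y h1 p + variation x y h2 p.
  by rewrite /variation -big_split/=; apply: eq_bigr => k _; rewrite hE.
(* Only two facts about this difference are used: it dominates the increments of [h1], and its total
   growth is controlled by the single partition [l]. *)
pose P x := tv a x h - tv a x h2.
have PB x y : a <= x -> x <= y -> y <= b -> `|h1 y - h1 x| <= P y - P x.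
  move=> ax xy yb; have ay := le_trans ax xy.
  have bhy := bounded_variationl ay yb bh; have bh2y := bounded_variationl ay yb bh2.
  rewrite /P (tvD ax xy bhy) (tvD ax xy bh2y).
  have bhxy := bounded_variationr ax xy bhy; have bh2xy := bounded_variationr ax xy bh2y.
  suff : `|h1 y - h1 x| + tv x y h2 <= tv x y h by lra.
  apply/ler_addgt0Pr => d d0; have [p xyp Hp] := tv_adherent xy bh2xy d0.
  have := tv_ub xy bhxy xyp; rewrite vE.
  suff : `|h1 y - h1 x| <= variation x y h1 p by lra.
  rewrite /variation.
  pose F k := h1 (nth y (x :: p) k).
  have -> : h1 y - h1 x = \sum_(0 <= k < size p) (F k.+1 - F k).
    by rewrite telescope_sumr// /F/= (itv_partition_nth_size _ xyp).
  exact: ler_norm_sum.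
exists s, P; split => //.
  move=> x y; rewrite !in_itv/= => /andP[ax xb] /andP[ay yb] xy.
  by rewrite -subr_ge0; apply: le_trans (PB _ _ ax xy yb); exact: normr_ge0.
have -> : P b - P a = tv a b h - tv a b h2.
  by rewrite /P /tv !total_variationxx/= !subr0.
have := tv_ub ab bh2 abl.
suff : variation a b h1 l <= e / 2 by have := vE a b l; lra.
apply: (@le_trans _ _ (\sum_(0 <= k < size l) s)).
  rewrite /variation ler_sum_nat// => k _.
  have H x : 0 <= h1 x <= s by rewrite /h1 le_min h0 (ltW s0) ge_min lexx orbT.
  have /andP[x0 xs] := H (nth b (a :: l) k.+1).
  have /andP[y0 ys] := H (nth b (a :: l) k).
  rewrite ler_norml; apply/andP; split.
    by rewrite lerNl opprB (le_trans _ ys)// gerBl.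
  by rewrite (le_trans _ xs)// gerBl.
rewrite big_const_nat iter_addr_0 subn0 -[leLHS]mulr_natr /s -mulrA ler_piMr ?(ltW e2)//.
by rewrite ler_pdivrMl// mulr1 ler_nat.
Qed.

End bounded_variation.

(** * Maximal functions expressed through a primitive *)

Section window_maximal.
Context {R : realType}.
Implicit Types (F g P : R -> R) (K r d x y al be : R).

Definition avg F al be : R := (F be - F al) / (be - al).

(** [F] stands for a primitive of [|f|], and windows range over the whole line. The case [d = 0] is
    the maximal function itself, and a positive [d] excludes short windows. *)
Definition window_sup F r d x : R :=
  sup [set v | exists al be, [/\ al <= x, x <= be, al < be, d <= be - al <= r &
    v = avg F al be]].

(** This is the supremum of [window_sup F r 0] over []-oo, y]], because a window meets that
    half-line exactly when it starts at or before [y]. In this form a window whose average exceeds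
    [start_sup F r y] must start to the right of [y]. *)
Definition start_sup F r y : R :=
  sup [set v | exists al be, [/\ al <= y, al < be, be - al <= r & v = avg F al be]].

Definition lipschitz_nd F K :=
  forall x y, x <= y -> 0 <= F y - F x <= K * (y - x).

Variables (F : R -> R) (K r : R).
Hypotheses (FK : lipschitz_nd F K) (r0 : 0 < r).
Local Notation M := (window_sup F r).
Local Notation N := (start_sup F r).

Lemma avg_bounds al be : al < be -> 0 <= avg F al be <= K.
Proof.
move=> ab; have ab0 : 0 < be - al by rewrite subr_gt0.
have /andP[H1 H2] := FK (ltW ab).
by rewrite /avg divr_ge0 ?(ltW ab0)//= ler_pdivrMr.
Qed.

Lemma lipschitz_nd_ge0 : 0 <= K.
Proof. by have /andP[H1 H2] := avg_bounds (@ltr01 R); exact: le_trans H2. Qed.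

Lemma window_sup_ge d x al be : al <= x -> x <= be -> al < be ->
  d <= be - al <= r -> avg F al be <= M d x.
Proof.
move=> ax xb ab dr; apply: ub_le_sup; last by exists al, be.
by exists K => _ [al' [be' [_ _ ab' _ ->]]]; have /andP[] := avg_bounds ab'.
Qed.

Lemma window_sup_adherent d x e : d <= r -> 0 < e ->
  exists al be, [/\ al <= x, x <= be, al < be, d <= be - al <= r &
    M d x - e < avg F al be].
Proof.
move=> dr e0.
have := @sup_adherent R [set v | exists al be, [/\ al <= x, x <= be, al < be,
  d <= be - al <= r & v = avg F al be]] e e0.
case.
  split.
    exists (avg F x (x + r)); exists x, (x + r).
    by rewrite lexx lerDl ltrDl (ltW r0) r0 addrAC subrr add0r dr lexx.
  by exists K => _ [al' [be' [_ _ ab' _ ->]]]; have /andP[] := avg_bounds ab'.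
by move=> _ [al [be [h1 h2 h3 h4 ->]]] h5; exists al, be.
Qed.

Lemma start_sup_ge y al be : al <= y -> al < be -> be - al <= r ->
  avg F al be <= N y.
Proof.
move=> ay ab br; apply: ub_le_sup; last by exists al, be.
by exists K => _ [al' [be' [_ ab' _ ->]]]; have /andP[] := avg_bounds ab'.
Qed.

Lemma start_sup_adherent y e : 0 < e ->
  exists al be, [/\ al <= y, al < be, be - al <= r & N y - e < avg F al be].
Proof.
move=> e0.
have := @sup_adherent R [set v | exists al be, [/\ al <= y, al < be,
  be - al <= r & v = avg F al be]] e e0.
case.
  split.
    exists (avg F y (y + r)); exists y, (y + r).
    by rewrite lexx ltrDl r0 addrAC subrr add0r lexx.
  by exists K => _ [al' [be' [_ ab' _ ->]]]; have /andP[] := avg_bounds ab'.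
by move=> _ [al [be [h1 h2 h3 ->]]] h5; exists al, be.
Qed.

Lemma start_sup_lt_adherent y c : c < N y ->
  exists al be, [/\ al <= y, al < be, be - al <= r & c < avg F al be].
Proof.
rewrite -subr_gt0 => /(start_sup_adherent y)[al [be [h1 h2 h3]]].
by rewrite opprB addrCA subrr addr0; exists al, be.
Qed.

Lemma start_sup_nd : {homo N : x y / x <= y}.
Proof.
move=> x y xy; apply/ler_addgt0Pr => e e0.
have [al [be [h1 h2 h3 h4]]] := start_sup_adherent x e0.
have := start_sup_ge (le_trans h1 xy) h2 h3; lra.
Qed.

Lemma window_le_start d x : d <= r -> M d x <= N x.
Proof.
move=> dr; apply/ler_addgt0Pr => e e0.
have [al [be [h1 _ h2 /andP[_ h3] h4]]] := window_sup_adherent x dr e0.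
have := start_sup_ge h1 h2 h3; lra.
Qed.

Lemma window_sup_anti d d' x : d <= d' -> d' <= r -> M d' x <= M d x.
Proof.
move=> dd' d'r; apply/ler_addgt0Pr => e e0.
have [al [be [h1 h2 h3 /andP[h4 h5] h6]]] := window_sup_adherent x d'r e0.
have := window_sup_ge h1 h2 h3 (introT andP (conj (le_trans dd' h4) h5)); lra.
Qed.

(** The numerator is the difference of two increments of [F] over distance [|h|]. Up to the common
    sign of [h], both lie between [0] and [K * |h|], so their difference is at most [K * |h|]. *)
Lemma avg_shift al be h : al < be ->
  `|avg F (al + h) (be + h) - avg F al be| <= K * `|h| / (be - al).
Proof.
move=> ab; have ab0 : 0 < be - al by rewrite subr_gt0.
have -> : avg F (al + h) (be + h) - avg F al be =
    ((F (be + h) - F be) - (F (al + h) - F al)) / (be - al).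
  rewrite /avg.
  have -> : be + h - (al + h) = be - al by ring.
  by rewrite -mulrBl; congr (_ / _); ring.
rewrite normrM normfV (gtr0_norm ab0) ler_pM2r ?invr_gt0//.
have H x : 0 <= Num.sg h * (F (x + h) - F x) <= K * `|h|.
  have [h0|h0|->] := ltgtP h 0.
  - rewrite ltr0_sg// ltr0_norm//.
    have /FK : x + h <= x by rewrite gerDl ltW.
    have -> : x - (x + h) = - h by ring.
    by rewrite mulN1r opprB.
  - rewrite gtr0_sg// gtr0_norm// mul1r.
    have /FK : x <= x + h by rewrite lerDl ltW.
    by rewrite addrAC subrr add0r.
  - by rewrite sgr0 mul0r normr0 mulr0 lexx.
have [->|h0] := eqVneq h 0; first by rewrite !addr0 !subrr normr0 mulr0.
have -> : `|F (be + h) - F be - (F (al + h) - F al)| =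
    `|Num.sg h * (F (be + h) - F be) - Num.sg h * (F (al + h) - F al)|.
  by rewrite -mulrBr normrM normr_sg h0 mul1r.
have /andP[b1 b2] := H be; have /andP[a1 a2] := H al.
rewrite ler_norml; apply/andP; split.
  by rewrite lerNl opprB (le_trans _ a2)// gerBl.
by rewrite (le_trans _ b2)// gerBl.
Qed.

(** A nearly optimal window for [y], shifted by [x - y], competes at [x]. Its length is at least
    [d], so by [avg_shift] the average changes by at most [K / d * |y - x|]. *)
Lemma window_sup_lipschitz d x y : 0 < d -> d <= r ->
  M d y - M d x <= K / d * `|y - x|.
Proof.
move=> d0 dr; apply/ler_addgt0Pr => e e0.
have [al [be [h1 h2 h3 /andP[h4 h5] h6]]] := window_sup_adherent y dr e0.
have := @avg_shift al be (x - y) h3; rewrite ler_norml => /andP[H _].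
have E : be + (x - y) - (al + (x - y)) = be - al by ring.
have H' : avg F (al + (x - y)) (be + (x - y)) <= M d x.
  by apply: window_sup_ge; rewrite ?E ?h4//; lra.
have : K * `|x - y| / (be - al) <= K / d * `|y - x|.
  rewrite distrC mulrAC ler_wpM2r// ler_wpM2l ?lipschitz_nd_ge0//.
  by rewrite lef_pV2 ?posrE// subr_gt0.
lra.
Qed.

(** A nearly optimal window for [y], shifted left by [y - t], competes at [t]. The admissible
    distance depends on the length of that window; [K + 1] replaces [K] to avoid a division by
    zero. *)
Lemma start_sup_left_lsc a b : left_lsc a b N.
Proof.
move=> y _ e e0; have e2 : 0 < e / 2 by lra.
have [al [be [h1 h2 h3 h4]]] := start_sup_adherent y e2.
have ab0 : 0 < be - al by rewrite subr_gt0.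
have K1 : 0 < K + 1 by rewrite ltr_wpDl// lipschitz_nd_ge0.
exists (e / 2 * (be - al) / (K + 1)); first by rewrite divr_gt0// mulr_gt0.
move=> t yt ty.
have := @avg_shift al be (t - y) h2; rewrite ler_norml => /andP[H _].
have E : be + (t - y) - (al + (t - y)) = be - al by ring.
have H' : avg F (al + (t - y)) (be + (t - y)) <= N t.
  by apply: start_sup_ge; rewrite ?E//; lra.
have : K * `|t - y| / (be - al) <= e / 2.
  rewrite ler_pdivrMr// ler0_norm ?subr_le0// opprB.
  have : y - t < e / 2 * (be - al) / (K + 1) by lra.
  rewrite ltr_pdivlMr// => h; apply: le_trans (ltW h).
  by rewrite mulrC ler_wpM2l ?subr_ge0// lerDl.
lra.
Qed.

End window_maximal.

(** * Density points and transfer of derivatives *)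

Section sandwich.
Context {R : realType}.
Local Notation mu := (@lebesgue_measure R).
Implicit Types (A : set R) (U M N : R -> R) (C x l : R).

Definition right_dense A x := forall e : R, 0 < e -> exists2 d : R, 0 < d &
  forall t, `|t - x| < d -> exists u, [/\ A u, t <= u & u <= t + e * `|t - x|].

(** This holds at density points. With [s = |t - x|], a hole of length [e * s] starting at [t] lies
    in the ball of radius [(1 + e) * s] around [x] and takes up the fixed proportion
    [e / (2 * (1 + e))] of it, which contradicts density [1] for small [s]. *)
Lemma ae_right_dense A : measurable A -> {ae mu, forall x, A x -> right_dense A x}.
Proof.
move=> mA; have := lebesgue_density mA.
apply: filterS; first exact: (ae_filter_ringOfSetsType mu).
move=> x dx Ax e e0; move: dx; rewrite indicE mem_set// => dx.
pose c := 1 - e / (2 * (1 + e)).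
have e1 : 0 < 1 + e by rewrite addr_gt0.
have c1 : c < 1 by rewrite /c gtrBl divr_gt0// mulr_gt0.
have : \forall rho \near 0^'+,
    (c%:E < mu (A `&` ball x rho) * (mu (ball x rho))^-1)%E.
  have ce : (c%:E < 1%:E)%E by rewrite lte_fin.
  exact: (dx _ (open_ereal_gt' ce)).
move=> [d /= d0 Hd].
have d1 : 0 < d / (1 + e) by rewrite divr_gt0.
exists (d / (1 + e)) => // t td.
have [->|tx] := eqVneq t x; first by exists x; rewrite subrr normr0 mulr0 addr0.
apply: contrapT => nA.
have s0 : 0 < `|t - x| by rewrite normr_gt0 subr_eq0.
set s := `|t - x| in td nA s0.
pose rho := (1 + e) * s.
have rho0 : 0 < rho by rewrite mulr_gt0.
have rhod : rho < d by move: td; rewrite ltr_pdivlMr// mulrC.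
have := Hd rho; rewrite /= sub0r normrN gtr0_norm// => /(_ rhod rho0).
apply/negP; rewrite -leNgt.
have -> : mu (ball x rho) = (2 * rho)%:E.
  by rewrite lebesgue_measure_ball ?(ltW rho0)// mulr_natl.
rewrite inver mulf_eq0 pnatr_eq0/= gt_eqF// lee_pdivrMr ?mulr_gt0//.
have -> : (c%:E * (2 * rho)%:E = (2 * rho)%:E - (e * s)%:E)%E.
  rewrite -EFinM -EFinB; congr EFin; rewrite /c /rho; field.
  by rewrite gt_eqF.
have I1 : mu `]t, t + e * s[ = (e * s)%:E.
  rewrite lebesgue_measure_itv/= lte_fin ltrDl mulr_gt0// -EFinB.
  by congr EFin; ring.
rewrite -I1 leeBrDr; last by rewrite I1.
have mb := measurable_ball x rho.
rewrite -measureU//=; last 2 first.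
- exact: measurableI.
- apply/seteqP; split => // z [[Az _]] /=; rewrite in_itv/= => /andP[tz zt].
  by apply: nA; exists z; split=> //; exact: ltW.
rewrite -[leRHS](_ : mu (ball x rho) = _); last first.
  by rewrite lebesgue_measure_ball ?(ltW rho0)// mulr_natl.
rewrite le_measure ?inE//; first by apply: measurableU => //; exact: measurableI.
rewrite subUset; split; first exact: subIsetr.
move=> z /=; rewrite in_itv/= => /andP[tz zt]; rewrite /ball/= distrC ltr_norml.
have : - s <= t - x <= s by rewrite -ler_norml.
rewrite /rho mulrDl mul1r.
have : 0 < e * s by rewrite mulr_gt0.
move: tz zt; lra.
Qed.

(** From below, [M t] is at least [U t]. From above, take [u] slightly to the right of [t] with
    [U u = N u]: then [M t <= N t <= N u = U u], and [U u] exceeds [U t] by at most [C * (u - t)],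
    which is small compared with [|t - x|]. *)
Lemma sandwich_slope U M N C x l :
  (forall t, U t <= M t <= N t) -> {homo N : t u / t <= u} ->
  (forall t u, U u - U t <= C * `|u - t|) -> U x = N x ->
  right_dense [set t | U t = N t] x -> has_slope U x l -> has_slope M x l.
Proof.
move=> UMN ndN UC UNx dx Ul e e0.
have C0 : 0 < `|C| + 1 by rewrite ltr_wpDl.
have e1 : 0 < e / (2 * (`|C| + 1)) by rewrite divr_gt0// mulr_gt0.
have e2 : 0 < e / 2 by lra.
have [d1 d10 H1] := dx _ e1; have [d2 d20 H2] := Ul _ e2.
exists (Num.min d1 d2); first by rewrite lt_min d10.
move=> t; rewrite lt_min => /andP[/H1 [u [/= Uu tu ut]] /H2].
have Mx : M x = U x by have := UMN x; rewrite -UNx; lra.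
rewrite Mx; have /andP[h1 h2] := UMN t.
have h3 := ndN _ _ tu.
have h4 : U u - U t <= e / 2 * `|t - x|.
  apply: le_trans (UC _ _) _; rewrite ger0_norm ?subr_ge0//.
  apply: (@le_trans _ _ ((`|C| + 1) * (e / (2 * (`|C| + 1)) * `|t - x|))).
    apply: (@le_trans _ _ ((`|C| + 1) * (u - t))).
      by rewrite ler_wpM2r ?subr_ge0// (le_trans (ler_norm C))// lerDl.
    by rewrite ler_wpM2l ?(ltW C0)//; lra.
  rewrite le_eqVlt; apply/orP; left; apply/eqP; field.
  by rewrite gt_eqF.
rewrite !ler_norml => /andP[h5 h6]; apply/andP; split; lra.
Qed.

End sandwich.

(** * Local growth of [N] and its integral bound *)

Section steps.
Context {R : realType}.
Implicit Types (x y u t e d c : R).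

(* Stands for [F' = g] without mentioning an integral. *)
Definition averages (F g : R -> R) := forall al be c, al < be ->
  ((forall u, al < u < be -> g u <= c) -> avg F al be <= c) /\
  ((forall u, al < u < be -> c <= g u) -> c <= avg F al be).

(** These minimal lengths tend to [0]; the cap [r] ensures that windows of length between
    [scale r n] and [r] exist. *)
Definition scale (r : R) (n : nat) : R := Num.min r n.+1%:R^-1.

Variables (F g : R -> R) (K r a b : R).
Hypotheses (FK : lipschitz_nd F K) (r0 : 0 < r) (Fg : averages F g).
Hypothesis (bg : bounded_variation a b g).
Local Notation M := (window_sup F r).
Local Notation N := (start_sup F r).

Lemma scale_gt0 n : 0 < scale r n.
Proof. by rewrite /scale lt_min r0 invr_gt0/=. Qed.

Lemma scale_le n : scale r n <= r.
Proof. by rewrite /scale ge_min lexx. Qed.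

(** * Points to the right of which [N] grows through ever shorter windows *)

Section steep_point.
Variable y : R.
Hypothesis yab : a <= y < b.
Hypothesis Ny : forall t, y < t -> N y < N t.
Hypothesis My : forall n, exists2 d : R, 0 < d &
  forall t, y < t -> t < y + d -> M (scale r n) t < N t.

(** Take [t] close to [y] and a window whose average exceeds [N y], [c] and [M (scale r n) t]. The
    first bound makes it start to the right of [y], the last makes it short, so it lies in []y, y +
    d[]. As its average exceeds [c], so does [g] somewhere inside. *)
Lemma steep_peak c d : 0 < d -> (forall t, y < t -> c < N t) ->
  exists u, [/\ y < u, u < y + d & c < g u].
Proof.
move=> d0 cN.
pose n := Num.truncn (2 / d).
have n0 : n.+1%:R^-1 < d / 2.
  rewrite invf_plt ?posrE ?divr_gt0// invf_div; exact: truncnS_gt.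
have [d1 d10 Hd1] := My n.
(* The bound [scale r n] matters: a window that starts to the right of [y] and has at least this
   length contains [t], so it competes for [M (scale r n) t]. *)
pose q := Num.min d1 (Num.min (scale r n) (d / 2)).
have q0 : 0 < q by rewrite lt_min d10 lt_min (scale_gt0 n) divr_gt0.
pose t := y + q / 2.
have yt : y < t by rewrite ltrDl divr_gt0.
have tq : t < y + q by rewrite ltrD2l; lra.
have [q1 q2 q3] : [/\ q <= d1, q <= scale r n & q <= d / 2].
  have H (u v w : R) : [/\ Num.min u (Num.min v w) <= u,
      Num.min u (Num.min v w) <= v & Num.min u (Num.min v w) <= w].
    by split; rewrite !ge_min lexx ?orbT.
  exact: H.
have : Num.max (Num.max (N y) c) (M (scale r n) t) < N t.
  by rewrite !gt_max Ny// cN//= Hd1//; lra.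
move=> /(start_sup_lt_adherent FK r0)[al [be [h1 h2 h3]]].
rewrite !gt_max => /andP[/andP[h4 h5] h6].
have yal : y < al.
  rewrite ltNge; apply/negP => aly.
  by have := start_sup_ge FK aly h2 h3; lra.
have bea : be - al < scale r n.
  rewrite ltNge; apply/negP => H.
  have : avg F al be <= M (scale r n) t.
    by apply: (window_sup_ge FK) => //; [lra|rewrite H].
  by lra.
have sn : scale r n < d / 2.
  by apply: le_lt_trans n0; rewrite /scale ge_min lexx orbT.
clear n0.
apply: contrapT => nu.
have : avg F al be <= c.
  apply: (Fg c h2).1 => u /andP[u1 u2]; rewrite leNgt; apply/negP => cu.
  by apply: nu; exists u; split => //; lra.
lra.
Qed.

(** Otherwise [g] stays above a line of slope [e] through height [N y], and some window starting at
    [y] has average greater than [N y]. *)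
Lemma start_sup_dip e d : 0 < e -> 0 < d ->
  exists u, [/\ y < u, u < y + d & g u <= N y + e * (u - y)].
Proof.
move=> e0 d0; apply: contrapT => nu.
pose q := Num.min d r.
have q0 : 0 < q by rewrite lt_min d0.
have [q1 q2] : q <= d /\ q <= r by rewrite /q !ge_min !lexx orbT.
have gu u : y < u -> u < y + q -> N y + e * (u - y) < g u.
  move=> yu uq; rewrite ltNge; apply/negP => H.
  by apply: nu; exists u; split => //; lra.
have yz : y < y + q / 2 by rewrite ltrDl divr_gt0.
have zw : y + q / 2 < y + q by rewrite ltrD2l; lra.
have A1 : N y <= avg F y (y + q / 2).
  apply: (Fg _ yz).2 => u /andP[u1 u2].
  apply: (@le_trans _ _ (N y + e * (u - y))); last by apply/ltW/gu => //; lra.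
  by rewrite lerDl mulr_ge0 ?subr_ge0// ltW.
have A2 : N y + e * (q / 2) <= avg F (y + q / 2) (y + q).
  apply: (Fg _ zw).2 => u /andP[u1 u2].
  apply: (@le_trans _ _ (N y + e * (u - y))); last by apply/ltW/gu => //; lra.
  by rewrite lerD2l ler_wpM2l ?(ltW e0)//; lra.
have : avg F y (y + q) <= N y by apply: (start_sup_ge FK) => //; lra.
have eq : avg F y (y + q) = (avg F y (y + q / 2) + avg F (y + q / 2) (y + q)) / 2.
  rewrite /avg.
  have -> : y + q - (y + q / 2) = q / 2 by lra.
  have -> : y + q / 2 - y = q / 2 by lra.
  have -> : y + q - y = q by lra.
  by field; rewrite gt_eqF.
have : 0 < e * (q / 2) by rewrite mulr_gt0// divr_gt0.
rewrite eq; lra.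
Qed.

(** If [N] jumped by more than [e] at [y], then [steep_peak] and [start_sup_dip] would give points
    arbitrarily close to the right of [y] where [g] is above [N y + e] and others where it is below
    [N y + e / 2]. This contradicts the right limit of [g]. *)
Lemma start_sup_right_continuous e : 0 < e -> exists2 d : R, 0 < d &
  forall t, y < t -> t < y + d -> N t <= N y + e.
Proof.
move=> e0; have [[t0 [yt0 Nt0]]|H] :=
    pselect (exists t0, y < t0 /\ N t0 <= N y + e).
  exists (t0 - y); first by rewrite subr_gt0.
  move=> t yt tt0; apply: le_trans Nt0; apply: (start_sup_nd FK r0); lra.
have e4 : 0 < e / 4 by lra.
have [d d0 Hd] := bounded_variation_right_cauchy bg yab e4.
have dm : 0 < Num.min d 1 by rewrite lt_min d0 ltr01.
have [u [u1 u2 u3]] : exists u, [/\ y < u, u < y + Num.min d 1 & N y + e < g u].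
  by apply: steep_peak => // t yt; rewrite ltNge; apply/negP => ?; apply: H; exists t.
have [t [t1 t2 t3]] := start_sup_dip e4 dm.
have ud : Num.min d 1 <= d by rewrite ge_min lexx.
have ud1 : Num.min d 1 <= 1 by rewrite ge_min lexx orbT.
have : `|g u - g t| <= e / 4 by apply: Hd => //; lra.
rewrite ler_norml => /andP[_].
have : e / 4 * (t - y) <= e / 4 by rewrite ler_piMr//; lra.
lra.
Qed.

(** Take a dip [t] of [g], and then a peak [u] between [y] and [t]. The positive part of [N - g] is
    at least about [N t - N y] at [t] and nearly [0] at [u], so [P] must grow by about [N t - N y]
    from [u] to [t]. *)
Lemma steep_step s P e d : 0 < s ->
  {in `[a, b] &, nondecreasing_fun P} ->
  (forall u t, a <= u -> u <= t -> t <= b ->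
    `|Num.min (Num.max (N t - g t) 0) s - Num.min (Num.max (N u - g u) 0) s| <= P t - P u) ->
  0 < e -> 0 < d -> d <= b - y ->
  exists t, [/\ y < t, t < y + d & N t - N y <= P t - P y + e * (t - y)].
Proof.
move=> s0 ndP HP e0 d0 db.
have [d1 d10 Hd1] := start_sup_right_continuous s0.
have dm : 0 < Num.min d d1 by rewrite lt_min d0.
have e2 : 0 < e / 2 by lra.
have [t [t1 t2 t3]] := start_sup_dip e2 dm.
have [td td1] : Num.min d d1 <= d /\ Num.min d d1 <= d1 by rewrite !ge_min !lexx orbT.
exists t; split => //; first by lra.
have ty0 : 0 < t - y by rewrite subr_gt0.
(* The positive part of [N - g] will be at most [2 * e'] at [u], that is [e / 2 * (t - y)]. The
   other half of the error comes from the dip. *)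
pose e' := e / 4 * (t - y).
have e'0 : 0 < e' by rewrite mulr_gt0//; lra.
have [d2 d20 Hd2] := start_sup_right_continuous e'0.
have dm2 : 0 < Num.min (t - y) d2 by rewrite lt_min ty0.
have [u [u1 u2 u3]] : exists u, [/\ y < u, u < y + Num.min (t - y) d2 & N y - e' < g u].
  by apply: steep_peak => // z /Ny; lra.
have [m1 m2] : Num.min (t - y) d2 <= t - y /\ Num.min (t - y) d2 <= d2.
  by rewrite !ge_min !lexx orbT.
have /andP[ay yb] := yab.
have au : a <= u by lra.
have ut : u <= t by lra.
have tb : t <= b by lra.
have Nts : N t <= N y + s by apply: Hd1 => //; lra.
have Nue : N u <= N y + e' by apply: Hd2 => //; lra.
(* Truncating at [s] costs nothing here, because right continuity has placed [t] where
   [N t <= N y + s]. *)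
have : N t - N y - e / 2 * (t - y) <= Num.min (Num.max (N t - g t) 0) s.
  rewrite le_min le_max; apply/andP; split.
    by apply/orP; left; lra.
  have : 0 <= e / 2 * (t - y) by rewrite mulr_ge0// ltW.
  lra.
have : Num.min (Num.max (N u - g u) 0) s <= 2 * e'.
  rewrite ge_min ge_max; apply/orP; left; apply/andP; split; lra.
have Pyu : P y <= P u by apply: ndP; rewrite ?in_itv/= ?ay ?au ?(ltW yb)//=; lra.
have := HP u t au ut tb; rewrite ler_norml => /andP[_].
rewrite /e'; lra.
Qed.

End steep_point.

(** At each [y], either [N] is attained by windows of length at least some [scale r n] at points
    tending to [y] from the right, or [N] stays constant for a while or [steep_step] applies. The
    first case is charged to [psi], the others to a function [P] of total growth at most [e], and
    [creeping_integral] combines them. *)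
Lemma start_sup_growth (psi : R -> R) (Z : set R) : a < b ->
  lebesgue_measure.-integrable setT (EFin \o psi) -> (forall x, 0 <= psi x) ->
  lebesgue_measure.-negligible Z ->
  (forall y n, a <= y < b -> ~ Z y -> M (scale r n) y = N y ->
    exists2 l, `|l| <= psi y & has_slope (M 0) y l) ->
  N b - N a <= \int[lebesgue_measure]_(t in `]a, b]) psi t.
Proof.
move=> ab ipsi psi0 Z0 HZ.
apply/ler_addgt0Pr => e e0.
pose h x := Num.max (N x - g x) 0.
have bN : bounded_variation a b N.
  by apply: nondecreasing_bounded_variation => x y _ _; exact: (start_sup_nd FK r0).
have bh : bounded_variation a b h.
  apply: (@bounded_variation_le_dist _ a b h (N \- g)); last first.
    by apply: bounded_variationD => //; exact: bounded_variationN.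
  move=> x y _ _; rewrite /h /=.
  case: (leP (N x - g x) 0) => H1; case: (leP (N y - g y) 0) => H2.
  - by rewrite subrr normr0.
  - rewrite !ler0_norm; lra.
  - rewrite !ger0_norm; lra.
  - by [].
have h0 x : 0 <= h x by rewrite /h le_max lexx orbT.
have [s [P [s0 ndP Pe HP]]] := truncation_small_variation (ltW ab) bh h0 e0.
have lN : left_lsc a b N by exact: start_sup_left_lsc FK r0 a b.
suff : N b - N a <= P b - P a + \int[lebesgue_measure]_(t in `]a, b]) psi t by lra.
have ML n x u : M (scale r n) u - M (scale r n) x <= K / scale r n * `|u - x|.
  by apply: window_sup_lipschitz; rewrite ?scale_gt0 ?scale_le.
have MN n x : M (scale r n) x <= N x by apply: (window_le_start FK); rewrite ?scale_le.
have dichotomy y : a <= y < b ->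
  (exists n, forall d, 0 < d -> exists t, [/\ y < t, t < y + d & M (scale r n) t = N t]) \/
  (forall e' d : R, 0 < e' -> 0 < d ->
    exists t, [/\ y < t, t < y + d & N t - N y <= P t - P y + e' * (t - y)]).
  move=> yab; have /andP[ay yb] := yab; have yb0 : 0 < b - y by lra.
  have [|nex] := pselect (exists n, forall d, 0 < d ->
    exists t, [/\ y < t, t < y + d & M (scale r n) t = N t]); [by left|right].
  move=> e' d e'0 d0.
  have dm : 0 < Num.min d (b - y) by rewrite lt_min d0.
  have [dm1 dm2] : Num.min d (b - y) <= d /\ Num.min d (b - y) <= b - y.
    by rewrite !ge_min !lexx orbT.
  have [[t0 [yt0 Nt0]]|Ny] := pselect (exists t0, y < t0 /\ N t0 <= N y).
    pose t := y + Num.min (Num.min d (b - y)) (t0 - y) / 2.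
    have q0 : 0 < Num.min (Num.min d (b - y)) (t0 - y) by rewrite lt_min dm subr_gt0.
    have [q1 q2] : Num.min (Num.min d (b - y)) (t0 - y) <= Num.min d (b - y) /\
        Num.min (Num.min d (b - y)) (t0 - y) <= t0 - y.
      by split; rewrite ge_min lexx ?orbT.
    have yt : y < t by rewrite ltrDl divr_gt0.
    exists t; split => //; first by rewrite /t; lra.
    have tt0 : t <= t0 by rewrite /t; lra.
    have tb : t <= b by rewrite /t; lra.
    have Nt := start_sup_nd FK r0 tt0.
    have : P y <= P t.
      by apply: ndP; rewrite ?in_itv/= ?ay ?tb ?(ltW yb) ?(ltW yt)//= andbT; lra.
    have : 0 <= e' * (t - y) by rewrite mulr_ge0 ?subr_ge0 ?(ltW yt)// ltW.
    lra.
  have [t [t1 t2 t3]] : exists t, [/\ y < t, t < y + Num.min d (b - y) &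
      N t - N y <= P t - P y + e' * (t - y)].
    apply: (@steep_step y yab _ _ s P) => //.
      by move=> t yt; rewrite ltNge; apply/negP => ?; apply: Ny; exists t.
    move=> n; apply: contrapT => H; apply: nex; exists n => d' d'0.
    apply: contrapT => H'; apply: H; exists d' => // t yt td'.
    rewrite lt_neqAle MN andbT; apply/eqP => H''; apply: H'.
    by exists t.
  by exists t; split => //; lra.
apply: (creeping_integral ab lN ndP ipsi psi0 Z0).
  move=> y yab nZ e' d e'0 d0.
  have [[n Hn]|] := dichotomy _ yab; last first.
    move=> /(_ _ _ e'0 d0)[t [t1 t2 t3]]; exists t; split => //.
    apply: le_trans t3 _; rewrite lerD2l ler_wpM2r ?subr_ge0 ?(ltW t1)//.
    by rewrite lerDr psi0.
  have /andP[ay yb] := yab.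
  (* The coincidence passes from points [t] tending to [y] to [y] itself, since [M (scale r n)] is
     Lipschitz and [N y <= N t]. *)
  have UN : M (scale r n) y = N y.
    apply/le_anti; rewrite MN/=; apply/ler_addgt0Pr => z z0.
    have C0 : 0 < K / scale r n + 1.
      by rewrite ltr_wpDl// divr_ge0 ?(lipschitz_nd_ge0 FK)// ltW// scale_gt0.
    have [t [t1 t2 t3]] := Hn _ (divr_gt0 z0 C0).
    have := ML n y t; rewrite t3 gtr0_norm ?subr_gt0//.
    have := start_sup_nd FK r0 (ltW t1).
    have : t - y < z / (K / scale r n + 1) by lra.
    rewrite ltr_pdivlMr// mulrC mulrDl mul1r.
    lra.
  have [l lpsi slo] := HZ y n yab nZ UN.
  have [d1 d10 Hd1] := slo _ e'0.
  have dm : 0 < Num.min (Num.min d d1) (b - y) by rewrite !lt_min d0 d10 subr_gt0.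
  have [t [t1 t2 t3]] := Hn _ dm.
  have [[m1 m2] m3] : (Num.min (Num.min d d1) (b - y) <= d /\
    Num.min (Num.min d d1) (b - y) <= d1) /\ Num.min (Num.min d d1) (b - y) <= b - y.
    by rewrite !ge_min !lexx !orbT.
  exists t; split => //; first by lra.
  have MM z : M (scale r n) z = N z -> M 0 z = N z.
    move=> H; apply/le_anti; rewrite (window_le_start FK r0) ?(ltW r0)//= -H.
    by apply: (window_sup_anti FK); rewrite ?scale_le// ltW// scale_gt0.
  rewrite -(MM t t3) -(MM y UN).
  have yt0 : 0 < t - y by lra.
  have := Hd1 t; rewrite gtr0_norm//.
  have td1 : t - y < d1 by lra.
  move=> /(_ td1); rewrite ler_norml => /andP[_].
  have : P y <= P t by apply: ndP; rewrite ?in_itv/= ?ay ?(ltW yb)//=; lra.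
  have : l * (t - y) <= psi y * (t - y).
    by rewrite ler_wpM2r ?(ltW yt0)// (le_trans (ler_norm _)).
  rewrite mulrDl; lra.
move=> y yab Zy.
have /andP[ay yb] := yab.
have [[n Hn]|H] := dichotomy _ yab; last by exists 1 => d d0; exact: H.
(* At exceptional points the Lipschitz constant of [M (scale r n)] serves as the finite rate. *)
exists (K / scale r n) => d d0.
have dm : 0 < Num.min d (b - y) by rewrite lt_min d0 subr_gt0.
have [t [t1 t2 t3]] := Hn _ dm.
have [m1 m2] : Num.min d (b - y) <= d /\ Num.min d (b - y) <= b - y.
  by rewrite !ge_min !lexx !orbT.
exists t; split => //; first by lra.
have := ML n y t; rewrite gtr0_norm ?subr_gt0//.
have : P y <= P t by apply: ndP; rewrite ?in_itv/= ?ay ?(ltW yb)//=; lra.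
have : M (scale r n) y <= N y by [].
rewrite -t3; lra.
Qed.

End steps.

(** * The derivative of [M] on the coincidence sets *)

Section window_slope.
Context {R : realType}.
Local Notation mu := (@lebesgue_measure R).
Variables (F : R -> R) (K r : R).
Hypotheses (FK : lipschitz_nd F K) (r0 : 0 < r).
Local Notation M := (window_sup F r).
Local Notation N := (start_sup F r).
Let U n := M (scale r n).
Let C n := K / scale r n.
(** The linear term makes the Lipschitz function [U n] nondecreasing, as [lipschitz_slope]
    requires. *)
Let G n x := U n x + C n * x.
Let A n := [set t | U n t = N t].

Let UC n x y : U n y - U n x <= C n * `|y - x|.
Proof. by apply: window_sup_lipschitz; rewrite ?scale_gt0 ?scale_le. Qed.

Let G_nd n : {homo G n : x y / x <= y}.
Proof.
move=> x y xy; have := UC n y x; rewrite distrC ger0_norm ?subr_ge0//.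
by rewrite /G mulrBr; lra.
Qed.

Let G_lip n x y : x <= y -> G n y - G n x <= 2 * C n * (y - x).
Proof.
move=> xy; have := UC n x y; rewrite ger0_norm ?subr_ge0//.
by rewrite /G -mulrA !mulrBr; lra.
Qed.

Let measurable_A n : measurable (A n).
Proof.
have -> : A n = setT `&` (fun t => G n t == N t + C n * t) @^-1` [set true].
  rewrite setTI; apply/seteqP; split=> t; rewrite /A/= /G.
    by move=> ->; rewrite eqxx.
  by move=> /eqP/addIr.
apply: measurable_fun_eqr => //.
  by apply: nondecreasing_measurable => //; exact: G_nd.
apply: measurable_funD => //.
by apply: nondecreasing_measurable => //; exact: (start_sup_nd FK r0).
Qed.

(** At almost every point of [A n], [U n] is differentiable and [A n] is dense, so [sandwich_slope]
    applies with [U n <= M 0 <= N]. The function [psi] is [|M'|] cut off outside the coincidence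
    sets: on these [M'] equals a measurable [D n], which makes [psi] measurable. *)
Lemma ae_window_slope : exists (Z : set R) (psi : R -> R),
  [/\ mu.-negligible Z, measurable_fun setT psi,
    forall x, 0 <= psi x <= `|derive1 (M 0) x| &
    forall x n, ~ Z x -> M (scale r n) x = N x ->
      exists2 l, `|l| <= psi x & has_slope (M 0) x l].
Proof.
pose D n x := upper_quot (G n) x - C n.
have : {ae mu, forall x, forall n,
    has_slope (U n) x (D n x) /\ (A n x -> right_dense (A n) x)}.
  apply: ae_foralln => n.
  apply: (@filterS2 _ _ (ae_filter_ringOfSetsType mu) _ _ _ _
    (lipschitz_slope (@G_nd n) (@G_lip n)) (ae_right_dense (measurable_A n))).
  move=> x slo dx; split => // e e0; have [d d0 Hd] := slo _ e0.
  exists d => // t td; have := Hd t td; rewrite /D /G.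
  by rewrite (_ : U n t + C n * t - (U n x + C n * x) - upper_quot (G n) x * (t - x) =
    U n t - U n x - (upper_quot (G n) x - C n) * (t - x)); last by ring.
move=> [Z [mZ Z0 HZ]].
have slo x n : ~ Z x -> A n x -> has_slope (M 0) x (D n x).
  move=> nZ Ax.
  have /(_ n)[slo /(_ Ax) dx] : forall n,
    has_slope (U n) x (D n x) /\ (A n x -> right_dense (A n) x).
    by apply: contrapT => H; apply: nZ; exact: HZ.
  apply: (sandwich_slope (N := N) _ _ (@UC n) Ax dx slo).
    move=> t; apply/andP; split.
      by apply: (window_sup_anti FK); rewrite ?scale_le// ltW// scale_gt0.
    by apply: (window_le_start FK) => //; exact: ltW.
  exact: (start_sup_nd FK r0).
pose E n := A n `\` Z.
have mE n : measurable (E n) by apply: measurableD.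
have ndE n m : (n <= m)%N -> E n `<=` E m.
  move=> nm x [Ax nZ]; split => //; rewrite /A/=.
  apply/le_anti; rewrite (window_le_start FK r0) ?scale_le//= -Ax.
  apply: (window_sup_anti FK r0); rewrite ?scale_le//.
  rewrite /scale le_min ge_min lexx/= ge_min; apply/orP; right.
  by rewrite lef_pV2 ?posrE// ler_nat.
have dE x n : E n x -> derive1 (M 0) x = D n x.
  by move=> [Ax nZ]; have /has_slopeP[] := slo _ _ nZ Ax.
pose psi := (fun x => `|derive1 (M 0) x|) \_ (\bigcup_n E n).
exists Z, psi; split.
- by exists Z; split.
- apply: (@measurable_fun_cvg _ _ _ _ (fun n => (fun x => `|D n x|) \_ (E n))).
    move=> n; apply/(measurable_restrictT _ _).1 => //.
    apply: measurable_funTS; apply: measurableT_comp => //.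
    apply: measurable_funB => //.
    exact: (measurable_upper_quot (@G_nd n) (@G_lip n)).
  move=> x _; have [[n _ Enx]|nE] := pselect ((\bigcup_n E n) x); last first.
    have -> : psi x = 0 by rewrite /psi patchE memNset.
    under eq_fun do rewrite patchE.
    apply: cvg_near_cst; apply: nearW => n.
    by rewrite memNset// => ?; apply: nE; exists n.
  apply: cvg_near_cst; near=> m.
  have Emx : E m x by apply: (ndE n) => //; near: m; exact: nbhs_infty_ge.
  rewrite /psi !patchE !mem_set//; first by rewrite (dE x m).
  by exists n.
- move=> x; rewrite /psi patchE; case: ifP => _; last by rewrite lexx normr_ge0.
  by rewrite normr_ge0 lexx.
move=> x n nZ Ax; exists (D n x); last exact: slo.
have Ex : E n x by [].
by rewrite /psi patchE mem_set; [rewrite (dE x n)|exists n].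
Unshelve. all: by end_near. Qed.

End window_slope.

(** * Monotonicity of the integral of nonnegative functions *)

Section le_integral_any.
Local Open Scope ereal_scope.

(** The integral is a supremum over simple functions below the integrand. This is applied with the
    squared derivative of the maximal function as [f2], whose measurability is not established. *)
Lemma ge0_le_integral_any d (T : measurableType d) (R : realType)
    (mu : {measure set T -> \bar R}) (D : set T) (f1 f2 : T -> \bar R) :
  (forall x, D x -> 0 <= f1 x) -> (forall x, D x -> f1 x <= f2 x) ->
  \int[mu]_(x in D) f1 x <= \int[mu]_(x in D) f2 x.
Proof.
move=> f10 f12; have f20 x : D x -> 0 <= f2 x.
  by move=> Dx; exact: le_trans (f10 _ Dx) (f12 _ Dx).
rewrite !ge0_integralE//; apply: ereal_sup_le => _ /= [h hf <-]; exists h => //.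
by move=> x; apply: le_trans (hf x) _; exact: lee_restrict.
Qed.

End le_integral_any.

(** * The inequality for [f] *)

Section application.
Context {R : realType}.
Local Notation mu := (@lebesgue_measure R).
Variables (a b : R) (f : R -> R) (r : R).
Hypotheses (ab : a < b) (bf : bounded_variation a b f) (r0 : 0 < r).
Hypothesis supp_f : supp_on a b f `<=` `[a + r, b - r].

(** Extending [|f|] by zero allows windows that leave [[a, b]]. *)
Let g : R -> R := (fun x => `|f x|) \_ `[a, b].
Let F y : R := \int[mu]_(t in `]-oo, y]) g t.

Let gE x : a <= x -> x <= b -> g x = `|f x|.
Proof. by move=> ax xb; rewrite /g patchE mem_set//= in_itv/= ax. Qed.

Let g_ge0 x : 0 <= g x.
Proof. by rewrite /g patchE; case: ifP. Qed.

Let g_out x : x < a + r \/ b - r < x -> g x = 0.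
Proof.
move=> xr; rewrite /g patchE; case: ifPn => // /set_mem /= xab.
apply/eqP; rewrite normr_eq0; apply: contrapT => /negP fx.
have /supp_f/= : supp_on a b f x by apply: subset_closure.
by rewrite in_itv/=; case: xr => xr /andP[]; lra.
Qed.

Let bg : bounded_variation a b g.
Proof.
apply: bounded_variation_le_dist bf => x y; rewrite !in_itv/=.
move=> /andP[ax xb] /andP[ay yb]; rewrite !gE//; exact: ler_dist_dist.
Qed.

Let K := sval (cid2 (bounded_variation_bounded bf)).

Let g_le x : g x <= K.
Proof.
rewrite /K; case: cid2 => //= k k0 Hk; rewrite /g patchE; case: ifP => // /set_mem.
exact: Hk.
Qed.

Let mg : measurable_fun setT g.
Proof.
apply/(measurable_restrictT _ _).1 => //.
by apply: measurableT_comp => //; exact: bounded_variation_measurable.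
Qed.

Let ig : mu.-integrable setT (EFin \o g).
Proof.
have -> : g = g \_ `[a, b].
  apply/funext => x; rewrite patchE; case: ifPn => // /negP xab.
  by rewrite /g patchE; case: ifP.
by apply: (@bounded_restr_integrable _ g K) => // y; rewrite g_ge0 g_le.
Qed.

Let FB x y : x <= y -> F y - F x = \int[mu]_(t in `]x, y]) g t.
Proof.
move=> xy; rewrite /F Rintegral_itvB//.
by apply: integrableS ig => //; exact: measurable_itv.
Qed.

Let igi (i : interval R) : mu.-integrable [set` i] (EFin \o g).
Proof. by apply: integrableS ig => //; exact: measurable_itv. Qed.

Let Fg : averages F g.
Proof.
move=> al be c albe.
have ic : mu.-integrable `]al, be[ (EFin \o cst c) by exact: integrable_cst_itv.
have -> : avg F al be = (\int[mu]_(t in `]al, be[) g t) / (be - al).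
  by rewrite /avg FB ?(ltW albe)// Rintegral_itv_bndo_bndc.
have E : c * (be - al) = \int[mu]_(t in `]al, be[) cst c t.
  by rewrite Rintegral_cst//= lebesgue_measure_itv/= lte_fin albe -EFinB.
have ba0 : 0 < be - al by rewrite subr_gt0.
split=> H.
  rewrite ler_pdivrMr// E; by apply: le_Rintegral.
rewrite ler_pdivlMr// E; by apply: le_Rintegral.
Qed.

Let FK : lipschitz_nd F K.
Proof.
move=> x y; rewrite le_eqVlt => /predU1P[->|xy].
  by rewrite !subrr mulr0 lexx.
have y0 : 0 < y - x by rewrite subr_gt0.
have := (Fg K xy).1 (fun u _ => g_le u).
have := (Fg 0 xy).2 (fun u _ => g_ge0 u).
by rewrite /avg ler_pdivrMr// ler_pdivlMr// mul0r => -> ->.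
Qed.

Let avg_out al be : al < be -> be <= a + r \/ b - r <= al -> avg F al be = 0.
Proof.
move=> albe H; apply/le_anti/andP; split; last first.
  by apply: (Fg 0 albe).2 => u _; exact: g_ge0.
apply: (Fg 0 albe).1 => u /andP[au ub]; rewrite g_out//.
by case: H => H; [left|right]; lra.
Qed.

Local Notation M := (window_sup F r).
Local Notation N := (start_sup F r).

Let averageE (i : interval R) al be : al < be -> [set` i] `<=` `[a, b] ->
  (\int[mu]_(y in [set` i]) (g y)%:E = \int[mu]_(y in `]al, be]) (g y)%:E)%E ->
  mu [set` i] = (be - al)%:E ->
  average f i = (avg F al be)%:E.
Proof.
move=> albe iab ig' mi; rewrite /average mi /=.
have -> : (\int[mu]_(y in [set` i]) `|f y|%:E = \int[mu]_(y in [set` i]) (g y)%:E)%E.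
  apply: eq_integral => y /set_mem /= /iab /=; rewrite in_itv/= => /andP[ay yb].
  by rewrite gE.
rewrite ig' -[X in (_ * X)%E]fineK; last exact: (integrable_fin_num _ (igi _)).
by rewrite -EFinM /avg FB ?(ltW albe)// mulrC.
Qed.

Let admissible_avg x i : admissible a b r x i ->
  exists al be, [/\ al <= x, x <= be, al < be, 0 <= be - al <= r &
    average f i = (avg F al be)%:E].
Proof.
move=> [iab xi]; rewrite lebesgue_measure_itv.
case: i iab xi => [[b1 al|[]] [b2 be|[]]] //= iab xi.
(* An unbounded or degenerate shape of interval has measure [0] or infinity, against [m0] or
   [mr]. *)
all: rewrite ?ltxx// => m0 mr.
all: try by rewrite ?ltry ?ltNyr ?ltNyy// in m0 mr.
have albe : al < be.
  by rewrite -lte_fin; apply: contraT => H; move: m0; rewrite (negbTE H) ltxx.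
move: mr; rewrite lte_fin albe -EFinB lee_fin => mr.
exists al, be; split => //.
- by case: b1 xi {iab} => /andP[]; rewrite !bnd_simp// => /ltW.
- by case: b2 xi {iab} => /andP[]; rewrite !bnd_simp// => _ /ltW.
- by rewrite mr subr_ge0 ltW.
apply: averageE => //.
  have mgi (j : interval R) : measurable_fun [set` j] (EFin \o g).
    exact/measurable_EFinP/measurable_funTS.
  case: b1 {iab xi}; case: b2.
  - by rewrite integral_itv_bndo_bndc// -integral_itv_obnd_cbnd.
  - by rewrite -integral_itv_obnd_cbnd.
  - by rewrite integral_itv_bndo_bndc.
  - by [].
by rewrite lebesgue_measure_itv/= lte_fin albe.
Qed.

Let admissible_itv x al be : a <= al -> be <= b -> al <= x -> x <= be -> al < be ->
  be - al <= r -> admissible a b r x `[al, be] /\ average f `[al, be] = (avg F al be)%:E.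
Proof.
move=> aal beb alx xbe albe ber.
have sub : `[al, be] `<=` `[a, b].
  by move=> y /=; rewrite !in_itv/= => /andP[h1 h2]; rewrite (le_trans aal)// (le_trans h2).
have m : mu `[al, be] = (be - al)%:E by rewrite lebesgue_measure_itv/= lte_fin albe.
split; first by split=> //; rewrite ?in_itv/= ?alx// ?m ?lte_fin ?subr_gt0.
apply: averageE => //; rewrite -integral_itv_obnd_cbnd//.
exact/measurable_EFinP/measurable_funTS.
Qed.

(** A window through [x] that sticks out of [[a, b]] has length at most [r], so it misses the
    support of [f] and has average [0]. Such windows do not change a supremum that is already
    nonnegative. *)
Let local_maximalE x : a <= x -> x <= b -> local_maximal a b r f x = M 0 x.
Proof.
move=> ax xb.
have nonneg : (0 <= local_maximal_ereal a b r f x)%E.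
  pose q := Num.min r (b - a) / 2.
  have q0 : 0 < Num.min r (b - a) by rewrite lt_min r0 subr_gt0.
  have [q1 q2] : Num.min r (b - a) <= r /\ Num.min r (b - a) <= b - a.
    by rewrite !ge_min !lexx orbT.
  (* A window of length at most [(b - a) / 2] fits on the right of [x] in the left half of [[a, b]],
     and on its left in the right half. *)
  have [al [be [h1 h2 [h3 h4 h5 h6]]]] : exists al be,
      [/\ a <= al, be <= b & [/\ al <= x, x <= be, al < be & be - al <= r]].
    have [xm|xm] := leP x ((a + b) / 2).
      by exists x, (x + q); rewrite /q; split; [| |split]; lra.
    by exists (x - q), x; rewrite /q; split; [| |split]; lra.
  have [adm avgE] := admissible_itv h1 h2 h3 h4 h5 h6.
  apply: (@le_trans _ _ (avg F al be)%:E).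
    by rewrite lee_fin; have /andP[] := avg_bounds FK h5.
  by rewrite -avgE; apply: ereal_sup_ubound; exists `[al, be].
suff E : local_maximal_ereal a b r f x = (M 0 x)%:E by rewrite /local_maximal E.
apply/le_anti/andP; split.
  apply: ge_ereal_sup => _ [i /admissible_avg[al [be [h1 h2 h3 h4 ->]]] <-].
  by rewrite lee_fin; exact: (window_sup_ge FK).
apply/lee_addgt0Pr => e e0.
have [al [be [h1 h2 h3 /andP[h4 h5] h6]]] := window_sup_adherent FK r0 x (ltW r0) e0.
apply: (@le_trans _ _ ((avg F al be)%:E + e%:E)%E).
  by rewrite -EFinD lee_fin; lra.
rewrite leeD2r//; have [aal|ala] := leP a al; last first.
  by rewrite avg_out//; left; lra.
have [beb|bbe] := leP be b; last by rewrite avg_out//; right; lra.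
have [adm avgE] := admissible_itv aal beb h1 h2 h3 h5.
by rewrite -avgE; apply: ereal_sup_ubound; exists `[al, be].
Qed.

Let N_a : N a <= 0.
Proof.
apply/ler_addgt0Pr => e e0; rewrite add0r.
have [al [be [h1 h2 h3 h4]]] := start_sup_adherent FK r0 a e0.
move: h4; rewrite avg_out//; first by lra.
by left; lra.
Qed.

Let N_b : 0 <= N b.
Proof.
have bbr : b < b + r by rewrite ltrDl.
have /andP[h _] := avg_bounds FK bbr.
apply: le_trans h _; apply: (start_sup_ge FK) => //; lra.
Qed.

(** The window from [x] to [t] starts at or before [b], so its average is at most [N b]; as [t]
    tends to [x] these averages tend to [|f x|] almost everywhere. *)
Let ae_f_le : {ae mu, forall x, `[a, b]%classic x -> ((f x) ^+ 2)%:E <= ((N b) ^+ 2)%:E}%E.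
Proof.
have := primitive_slope ig; apply: filterS; first exact: (ae_filter_ringOfSetsType mu).
move=> x slo /=; rewrite in_itv/= => /andP[ax xb].
rewrite lee_fin -(real_normK (num_real (f x))) ler_pXn2r ?nnegrE//.
rewrite -gE//; apply/ler_addgt0Pr => e e0.
have [d d0 Hd] := slo _ e0.
have dm : 0 < Num.min d r by rewrite lt_min d0.
have [m1 m2] : Num.min d r <= d /\ Num.min d r <= r by rewrite !ge_min !lexx orbT.
pose t := x + Num.min d r / 2.
have xt : x < t by rewrite ltrDl divr_gt0.
have t0 : 0 < t - x by rewrite subr_gt0.
have tr : t - x <= r by rewrite /t; lra.
have td : t - x < d by rewrite /t; lra.
have := start_sup_ge FK xb xt tr.
rewrite /avg ler_pdivrMr// => H.
have := Hd t; rewrite gtr0_norm// => /(_ td).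
rewrite ler_norml => /andP[+ _]; rewrite -/(F t) -/(F x) => H'.
have : g x * (t - x) <= (N b + e) * (t - x) by rewrite mulrDl; lra.
by rewrite ler_pM2r.
Qed.

Lemma start_sup_sqr_le :
  ((N b ^+ 2)%:E <= (b - a)%:E * \int[mu]_(x in `[a, b])
      ((derive1 (local_maximal a b r f) x) ^+ 2)%:E)%E.
Proof.
set I := (\int[mu]_(x in _) _)%E.
have I0 : (0 <= I)%E by apply: integral_ge0 => x _; rewrite lee_fin sqr_ge0.
have ba0 : 0 < b - a by rewrite subr_gt0.
have [Ify|] := ltP I +oo%E; last first.
  by rewrite leye_eq => /eqP ->; rewrite gt0_muley ?lte_fin// leey.
have [Z [psi0 [Z0 mpsi0 psi0B Hpsi]]] := ae_window_slope FK r0.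
(* The open interval is used because [local_maximal] agrees with [M 0] on [[a, b]] only, so their
   derivatives are compared at interior points. *)
pose psi := psi0 \_ `]a, b[.
have psiE x : a < x -> x < b -> psi x = psi0 x.
  by move=> ax xb; rewrite /psi patchE mem_set//= in_itv/= ax.
have psi_ge0 x : 0 <= psi x.
  by rewrite /psi patchE; case: ifP => // _; have /andP[] := psi0B x.
have psi_le x : psi x ^+ 2 <= (derive1 (local_maximal a b r f) x) ^+ 2.
  rewrite /psi patchE; case: ifPn => [|_]; last by rewrite expr0n/= sqr_ge0.
  move=> /set_mem/=; rewrite in_itv/= => /andP[ax xb].
  have /andP[p0 p1] := psi0B x.
  rewrite -[leRHS]real_normK ?num_real// ler_pXn2r ?nnegrE//.
  rewrite (_ : derive1 (local_maximal a b r f) x = derive1 (M 0) x)//.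
  rewrite !derive1E; apply: near_eq_derive.
  have xab : x \in `]a, b[ by rewrite in_itv/= ax.
  apply: filterS (near_in_itvoo xab) => z; rewrite in_itv/= => /andP[az zb].
  by rewrite local_maximalE ?ltW.
have mpsi : measurable_fun setT psi.
  by apply/(measurable_restrictT _ _).1 => //; exact: measurable_funTS.
have c1 (c : R) : mu.-integrable `[a, b] (EFin \o cst c) by exact: integrable_cst_itv.
have JI : (\int[mu]_(x in `[a, b]) (psi x ^+ 2)%:E <= I)%E.
  by apply: ge0_le_integral_any => x _; rewrite lee_fin ?sqr_ge0.
have ipsi2 : mu.-integrable `[a, b] (EFin \o (fun x => psi x ^+ 2)).
  apply/integrableP; split.
    by apply/measurable_EFinP; apply: measurable_funX; exact: measurable_funTS.
  under eq_integral do rewrite /= ger0_norm ?sqr_ge0//.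
  exact: le_lt_trans JI Ify.
have ipsi : mu.-integrable `[a, b] (EFin \o psi).
  (* Integrability follows from [psi <= 1 + psi ^ 2]. *)
  apply: (le_integrable _ _ _ (integrableD _ (c1 1) ipsi2)) => //.
    by apply/measurable_EFinP; exact: measurable_funTS.
  move=> x _ /=; rewrite lee_fin !ger0_norm//; last by rewrite addr_ge0// sqr_ge0.
  have := sqr_ge0 (psi x - 1); rewrite sqrrB1.
  have := psi_ge0 x; lra.
have ipsiT : mu.-integrable setT (EFin \o psi).
  have -> : psi = psi \_ `[a, b].
    apply/funext => x; rewrite [RHS]patchE; case: ifPn => // /negP xab.
    rewrite /psi patchE memNset//= => xab'; apply: xab; apply/mem_set => /=.
    by move: xab'; rewrite !in_itv/= => /andP[? ?]; rewrite !ltW.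
  by rewrite -restrict_EFin; apply/(integrable_mkcond _ _).1.
(* The point [a] becomes exceptional because the cut-off sets [psi a] to [0]. *)
have Za : mu.-negligible (Z `|` [set a]).
  apply: negligibleU => //; exists [set a]; split => //.
  exact: lebesgue_measure_set1.
have H : N b - N a <= \int[mu]_(t in `]a, b]) psi t.
  apply: (start_sup_growth FK r0 Fg bg ab ipsiT psi_ge0 Za).
  move=> y n /andP[ay yb] /not_orP[nZ ya] UN.
  have ay' : a < y by rewrite lt_neqAle ay andbT; apply/eqP => e; apply: ya.
  by rewrite psiE//; exact: Hpsi UN.
rewrite Rintegral_itv_obnd_cbnd in H; last first.
  by apply: integrableS ipsiT => //; exact: measurable_itv.
pose J := \int[mu]_(t in `[a, b]) (psi t ^+ 2).
have JE : (J%:E = \int[mu]_(x in `[a, b]) (psi x ^+ 2)%:E)%E.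
  by rewrite /J /Rintegral fineK//; exact: integrable_fin_num ipsi2.
suff S : N b ^+ 2 <= (b - a) * J.
  apply: (@le_trans _ _ ((b - a) * J)%:E); first by rewrite lee_fin.
  by rewrite EFinM JE lee_pmul2l ?lte_fin.
have J0 : 0 <= J by apply: Rintegral_ge0 => x _; exact: sqr_ge0.
move: N_b; rewrite le_eqVlt => /predU1P[<-|Nb0].
  by rewrite expr0n/= mulr_ge0// ltW.
(* This is the constant value of [psi] whose integral over [[a, b]] is [N b], the case of
   equality. *)
pose c := N b / (b - a).
have c0 : 0 < c by rewrite divr_gt0.
(* AM-GM: psi <= psi^2 / (2 c) + c / 2 *)
have : \int[mu]_(t in `[a, b]) psi t <=
    \int[mu]_(t in `[a, b]) ((2 * c)^-1 * psi t ^+ 2 + cst (c / 2) t).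
  apply: le_Rintegral => //.
    by have := integrableD _ (integrableZl _ (2 * c)^-1 ipsi2) (c1 (c / 2)); apply.
  move=> x _ /=; rewrite -subr_ge0.
  have -> : (2 * c)^-1 * psi x ^+ 2 + c / 2 - psi x = (psi x - c) ^+ 2 / (2 * c).
    by field; rewrite gt_eqF.
  by rewrite divr_ge0 ?sqr_ge0// mulr_ge0// ltW.
rewrite RintegralD//; last by have := integrableZl _ (2 * c)^-1 ipsi2; apply.
rewrite RintegralZl// -/J Rintegral_cst//= lebesgue_measure_itv/= lte_fin ab -EFinB/=.
have -> : (2 * c)^-1 * J = (b - a) * J / (2 * N b).
  by rewrite /c; field; rewrite !gt_eqF.
have -> : c / 2 * (b - a) = N b / 2 by rewrite /c; field; rewrite gt_eqF.
have : N b <= N b - N a by rewrite lerBrDr gerDl N_a.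
move=> /le_trans/(_ H)/le_trans/[apply].
rewrite {1}(splitr (N b)) lerD2r.
rewrite ler_pdivlMr ?mulr_gt0//.
by rewrite (_ : N b / 2 * (2 * N b) = N b ^+ 2)//; field.
Qed.


Lemma local_maximal_poincare :
  (\int[mu]_(x in `[a, b]) ((f x) ^+ 2)%:E <=
   ((b - a) ^+ 2)%:E * \int[mu]_(x in `[a, b])
     ((derive1 (local_maximal a b r f) x) ^+ 2)%:E)%E.
Proof.
apply: (@le_trans _ _ (\int[mu]_(x in `[a, b]) ((N b) ^+ 2)%:E)%E).
  apply: ae_ge0_le_integral => //.
  - by move=> x _; rewrite lee_fin sqr_ge0.
  - apply/measurable_EFinP; apply: measurable_funX.
    exact: bounded_variation_measurable.
  - by move=> x _; rewrite lee_fin sqr_ge0.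
rewrite integral_cst//= lebesgue_measure_itv/= lte_fin ab -EFinB.
have -> : (((b - a) ^+ 2)%:E = (b - a)%:E * (b - a)%:E)%E by rewrite -EFinM -expr2.
rewrite [leLHS]muleC -muleA lee_pmul2l ?lte_fin ?subr_gt0//.
exact: start_sup_sqr_le.
Qed.

End application.

Theorem theorem5p7 (R : realType) :
  exists c : R -> R,
    forall (a b : R) (f : R -> R) (r : R),
      a < b ->
      (total_variation a b f < +oo)%E ->
      0 < r ->
      supp_on a b f `<=` `[a + r, b - r] ->
      (\int[lebesgue_measure]_(x in `[a, b]) ((f x) ^+ 2)%:E <=
       (c (b - a))%:E *
       \int[lebesgue_measure]_(x in `[a, b])
          ((derive1 (local_maximal a b r f) x) ^+ 2)%:E)%E.
Proof.
exists (fun l => l ^+ 2) => a b f r ab tvf r0 supp_f.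
apply: local_maximal_poincare => //.
apply/(bounded_variationP _ (ltW ab)).
by rewrite ge0_fin_numE// total_variation_ge0// ltW.
Qed.
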